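(* Let $q$ be a power of $3$, let $L$ be a generic line of $PG(3,q)$, let $S$ be the set of the $q+1$ planes of $PG(3,q)$ containing $L$, and let $r=\jmath(f_L)$. (1) If $f_L\in\mathcal{F}_i$ with $i\in\{1,2,4\}$, then $|S\cap\mathcal{N}_1|=0$, $|S\cap\mathcal{N}_2|=i$, $|S\cap\mathcal{N}_4|=q+1-\frac{\#\mathcal{E}_r(\mathbb{F}_q)+i}{2}$, $|S\cap\mathcal{N}_3|=\frac{\#\mathcal{E}_r(\mathbb{F}_q)-3i}{6}$, and $|S\cap\mathcal{N}_5|=\frac{\#\mathcal{E}_r(\mathbb{F}_q)}{3}$. (2) If $f_L\in\mathcal{F}_2'\cup\mathcal{F}_4'$, then $|S\cap\mathcal{N}_1|=|S\cap\mathcal{N}_2|=0$, $|S\cap\mathcal{N}_4|=q+1-\frac{\#\mathcal{E}_r(\mathbb{F}_q)}{2}$, $|S\cap\mathcal{N}_3|=\frac{\#\mathcal{E}_r(\mathbb{F}_q)}{6}$, and $|S\cap\mathcal{N}_5|=\frac{\#\mathcal{E}_r(\mathbb{F}_q)}{3}$.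
   Context: Points of $PG(3,q)$ are written $(y_0:y_1:y_2:y_3)$; the twisted cubic is $C=\{(s^3:s^2t:st^2:t^3)\}$, with $C(K)$ the analogous set over a field $K\supseteq\mathbb{F}_q$. The osculating plane at $(s^3:s^2t:st^2:t^3)$ is $t^3y_0-s^3y_3=0$. A line is generic if it does not meet $C(\overline{\mathbb{F}_q})$ and is not contained in any osculating plane of $C$. For the line $L$ through distinct points $x,y$, Plücker coordinates are $p_{ij}=x_iy_j-x_jy_i$ and $f_L=p_{23}X^4+p_{13}X^3Y+p_{03}X^2Y^2+p_{02}XY^3+p_{01}Y^4$. For a quartic form $f=\sum z_iX^{4-i}Y^i$, $\Delta(f)=(z_0z_4-z_1z_3)^3+(z_0z_4-z_1z_3)^2z_2^2-z_2^3(z_0z_3^2+z_4z_1^2-z_0z_2z_4)$ and $\jmath(f)=z_2^6/\Delta(f)$ when $\Delta(f)\ne0$. Forms with $\Delta\ne0$ are of type $\mathcal{F}_4$ (four linear factors over $\mathbb{F}_q$), $\mathcal{F}_2$ (two linear and one irreducible quadratic factor), $\mathcal{F}_1$ (one linear and one irreducible cubic factor), $\mathcal{F}_4'$ (two irreducible quadratic factors), $\mathcal{F}_2'$ (irreducible). A plane $a_0y_0+a_1y_1+a_2y_2+a_3y_3=0$ is identified with the binary cubic form $a_0X^3+a_1X^2Y+a_2XY^2+a_3Y^3$ (up to scalar). The plane classes are: $\mathcal{N}_1$: the cubic is the cube of a linear form; $\mathcal{N}_2$: it is $\ell_1^2\ell_2$ with $\ell_1,\ell_2$ independent linear forms over $\mathbb{F}_q$;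 $\mathcal{N}_3$: product of three pairwise independent linear forms over $\mathbb{F}_q$; $\mathcal{N}_4$: product of a linear form and an irreducible quadratic over $\mathbb{F}_q$; $\mathcal{N}_5$: irreducible over $\mathbb{F}_q$. For $r\in\mathbb{F}_q^\times$, $\mathcal{E}_r$ is the elliptic curve $x^2=y^3+y^2-r^{-1}$ and $\#\mathcal{E}_r(\mathbb{F}_q)$ is the number of its $\mathbb{F}_q$-rational points in the projective plane, including the point at infinity. *)

(* Defs.v *)
From HB Require Import structures.
From mathcomp Require Import all_boot all_order all_algebra all_field.
From mathcomp Require Import mpoly.
From mathcomp.classical Require Import boolp.

Set Implicit Arguments.
Unset Strict Implicit.
Unset Printing Implicit Defensive.

Import GRing.Theory.

Local Open Scope ring_scope.

(* PG(n-1,q) is the lattice of subspaces of 'rV[F]_n with #|F| = q: points,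
   lines and planes are the subspaces of \dim 1, 2 and 3. *)
Section VspaceFinite.
Import VectorInternalTheory.
Variables (F : finFieldType) (vT : vectType F).
HB.instance Definition _ := [Countable of {vspace vT} by <:].
HB.instance Definition _ := [Finite of {vspace vT} by <:].
End VspaceFinite.

Definition y0 : 'I_4 := @Ordinal 4 0 isT.
Definition y1 : 'I_4 := @Ordinal 4 1 isT.
Definition y2 : 'I_4 := @Ordinal 4 2 isT.
Definition y3 : 'I_4 := @Ordinal 4 3 isT.

Definition row4 (R : Type) (a b c d : R) : 'rV[R]_4 :=
  \row_i tnth [tuple a; b; c; d] i.

Definition cubic_point (K : fieldType) (s t : K) : 'rV[K]_4 :=
  row4 (s ^+ 3) (s ^+ 2 * t) (s * t ^+ 2) (t ^+ 3).

(* The plane a_0 y_0 + a_1 y_1 + a_2 y_2 + a_3 y_3 = 0 (for a != 0). *)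
Definition plane (K : fieldType) (a : 'rV[K]_4) : {vspace 'rV[K]_4} :=
  lker (linfun (mulmxr a^T)).

Definition osc_plane (K : fieldType) (s t : K) : {vspace 'rV[K]_4} :=
  plane (row4 (t ^+ 3) 0 0 (- s ^+ 3)).

(* L as a line of PG(3,K), for a field extension iota : F -> K. *)
Definition extend_scalars (F K : fieldType) (iota : {rmorphism F -> K})
    (L : {vspace 'rV[F]_4}) : {vspace 'rV[K]_4} :=
  <<[seq map_mx iota v | v <- vbasis L]>>%VS.

(* K is meant to be an algebraic closure of F.  The osculating planes are those
   at the F-points of C; when F is finite of characteristic 3, taking those at
   the K-points instead gives the same notion, since F is perfect. *)
Definition generic (F K : fieldType) (iota : {rmorphism F -> K})
    (L : {vspace 'rV[F]_4}) : Prop :=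
  (forall s t : K, (s, t) != (0, 0) ->
     cubic_point s t \notin extend_scalars iota L) /\
  (forall s t : F, (s, t) != (0, 0) -> ~~ (L <= osc_plane s t)%VS).

Definition plucker (R : pzRingType) (x y : 'rV[R]_4) (i j : 'I_4) : R :=
  x 0 i * y 0 j - x 0 j * y 0 i.

(* The binary form \sum_i z_i X^(n-i) Y^i, with X = 'X_0 and Y = 'X_1. *)
Definition bform (F : fieldType) (n : nat) (z : 'rV[F]_n.+1) : {mpoly F[2]} :=
  \sum_(i < n.+1) z 0 i *: ('X_0 ^+ (n - i) * 'X_1 ^+ i).

Definition irreducible_elt (R : idomainType) (f : R) : Prop :=
  [/\ f != 0, f \isn't a GRing.unit
    & forall g h : R, f = g * h -> g \is a GRing.unit \/ h \is a GRing.unit].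

Section QuarticForms.
Variable F : fieldType.
Implicit Types z : 'rV[F]_5.

(* Coefficients z_0, ..., z_4 of the quartic form f_L, L being the line xy. *)
Definition line_quartic (x y : 'rV[F]_4) : 'rV[F]_5 :=
  let p := plucker x y in
  \row_i tnth [tuple p y2 y3; p y1 y3; p y0 y3; p y0 y2; p y0 y1] i.

Definition Delta z : F :=
  let z0 := z 0 (inord 0) in let z1 := z 0 (inord 1) in
  let z2 := z 0 (inord 2) in let z3 := z 0 (inord 3) in
  let z4 := z 0 (inord 4) in
  (z0 * z4 - z1 * z3) ^+ 3 + (z0 * z4 - z1 * z3) ^+ 2 * z2 ^+ 2
  - z2 ^+ 3 * (z0 * z3 ^+ 2 + z4 * z1 ^+ 2 - z0 * z2 * z4).

Definition jmath z : F := z 0 (inord 2) ^+ 6 / Delta z.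

Definition typeF4 z : Prop :=
  Delta z != 0 /\ exists l1 l2 l3 l4 : 'rV[F]_2,
    bform z = bform l1 * bform l2 * bform l3 * bform l4.

Definition typeF2 z : Prop :=
  Delta z != 0 /\ exists (l1 l2 : 'rV[F]_2) (g : 'rV[F]_3),
    irreducible_elt (bform g) /\ bform z = bform l1 * bform l2 * bform g.

Definition typeF1 z : Prop :=
  Delta z != 0 /\ exists (l : 'rV[F]_2) (g : 'rV[F]_4),
    irreducible_elt (bform g) /\ bform z = bform l * bform g.

Definition typeF4' z : Prop :=
  Delta z != 0 /\ exists g h : 'rV[F]_3,
    [/\ irreducible_elt (bform g), irreducible_elt (bform h)
      & bform z = bform g * bform h].

Definition typeF2' z : Prop :=
  Delta z != 0 /\ irreducible_elt (bform z).

End QuarticForms.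

Section PlaneClasses.
Variable F : finFieldType.

(* The planes whose binary cubic form, for some choice of its scalar factor,
   satisfies P. *)
Definition planes_with (P : {mpoly F[2]} -> Prop) : {set {vspace 'rV[F]_4}} :=
  [set plane a | a : 'rV[F]_4 & (a != 0) && `[< P (bform a) >]].

Definition N1 : {set {vspace 'rV[F]_4}} := planes_with (fun f =>
  exists l : 'rV[F]_2, f = bform l ^+ 3).

Definition N2 : {set {vspace 'rV[F]_4}} := planes_with (fun f =>
  exists l1 l2 : 'rV[F]_2,
    free [:: l1; l2] /\ f = bform l1 ^+ 2 * bform l2).

Definition N3 : {set {vspace 'rV[F]_4}} := planes_with (fun f =>
  exists l1 l2 l3 : 'rV[F]_2,
    [/\ free [:: l1; l2], free [:: l1; l3], free [:: l2; l3]
      & f = bform l1 * bform l2 * bform l3]).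

Definition N4 : {set {vspace 'rV[F]_4}} := planes_with (fun f =>
  exists (l : 'rV[F]_2) (g : 'rV[F]_3),
    irreducible_elt (bform g) /\ f = bform l * bform g).

Definition N5 : {set {vspace 'rV[F]_4}} := planes_with (@irreducible_elt _).

Definition planes_through (L : {vspace 'rV[F]_4}) : {set {vspace 'rV[F]_4}} :=
  [set H : {vspace 'rV[F]_4} | (\dim H == 3) && (L <= H)%VS].

(* Projective points (x:y:w) of the closure x^2 w = y^3 + y^2 w - r^-1 w^3 of
   the affine curve x^2 = y^3 + y^2 - r^-1; the point at infinity is (1:0:0). *)
Definition elliptic_points (r : F) : {set {vspace 'rV[F]_3}} :=
  [set P : {vspace 'rV[F]_3} | (\dim P == 1) &&
    [forall v : 'rV[F]_3, (v \in P) ==>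
      (let x := v 0 (inord 0) in let y := v 0 (inord 1) in
       let w := v 0 (inord 2) in
       x ^+ 2 * w == y ^+ 3 + y ^+ 2 * w - r^-1 * w ^+ 3)]].

End PlaneClasses.

(* Main.v *)
Require Import Defs.
From mathcomp Require Import all_boot all_order all_algebra all_field.
From mathcomp Require Import mpoly ring lra.

(* Since L lies in no osculating plane, p_03 is non-zero, and the planes through L
   are the cubics a_0 X^3 + a_1 X^2 Y + a_2 X Y^2 + a_3 Y^3 with (a_1 : a_2) free and
   a_0, a_3 linear in (a_1, a_2).  In characteristic 3 the discriminant of such a
   cubic is f_L(a_2, a_1) / p_03.  It vanishes exactly on N_2; it is a non-square
   exactly on N_4, because a cubic with non-square discriminant can be brought to
   the form y^3 - A y - B with A a non-square, and y |-> y^3 - A y is then bijective.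
   So |N_2| is the number of rational roots of f_L, the quadratic character of f_L
   sums over P^1 to |N_3| + |N_5| - |N_4|, and, Delta(f_L) being non-zero, every
   point of P^1 is a root of exactly one cubic of the pencil, so that
   2|N_2| + 3|N_3| + |N_4| = q + 1.

   It remains to see that this character sum is that of y^3 + y^2 - 1/r.  If f_L
   takes a square value at a point of P^1, move that point to infinity; the
   curve w^2 = f_L then has a Weierstrass equation by w = x^2 + u.  Otherwise, for n
   a non-square, n f_L takes only non-zero square values, so that its character sum
   is q + 1; but, n f_L having square values, this sum is also a sum of q character
   values: contradiction. *)

Set Implicit Arguments.
Unset Strict Implicit.
Unset Printing Implicit Defensive.

Import GRing.Theory Num.Theory.
Local Open Scope ring_scope.

(** * Binary forms over a field *)

Section BinaryForms.
Variable F : fieldType.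
Implicit Types (f g h : {mpoly F[2]}) (P : option F).

(** Explicit coefficient lists let identities between forms reduce to scalar identities for
    [ring]. *)
Definition rowseq n (s : seq F) : 'rV[F]_n.+1 := \row_i s`_i.

Lemma rowseqE n s k : (k <= n)%N -> rowseq n s 0 (inord k) = s`_k.
Proof. by move=> le_kn; rewrite mxE inordK. Qed.

Lemma rowseqP n (z : 'rV[F]_n.+1) :
  exists2 s : seq F, size s = n.+1 & z = rowseq n s.
Proof.
exists (mkseq (fun k => z 0 (inord k)) n.+1); first by rewrite size_mkseq.
by apply/rowP=> i; rewrite mxE nth_mkseq ?inord_val.
Qed.

Lemma bformE n (z : 'rV[F]_n.+1) : bform z =
  \sum_(0 <= i < n.+1) (z 0 (inord i))%:MP * ('X_0 ^+ (n - i) * 'X_1 ^+ i).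
Proof.
by rewrite big_mkord; apply: eq_bigr => i _; rewrite inord_val mul_mpolyC.
Qed.

Lemma bformZ n (c : F) (z : 'rV[F]_n.+1) : bform (c *: z) = c *: bform z.
Proof. by rewrite /bform scaler_sumr; apply: eq_bigr => i _; rewrite mxE scalerA. Qed.

(** Setting Y = 1 gives access to the coefficients, degrees and roots of one-variable
    polynomials. *)
Definition dehom f : {poly F} := mmap polyC (fun i => if i == 0 then 'X else 1) f.

Lemma dehomM f g : dehom (f * g) = dehom f * dehom g.
Proof. exact: rmorphM. Qed.

Lemma dehom_bform n (z : 'rV[F]_n.+1) i :
  (dehom (bform z))`_i = if (i <= n)%N then z 0 (inord (n - i)) else 0.
Proof.
rewrite /dehom /bform raddf_sum.
have -> : \sum_(j < n.+1) mmap polyC (fun i0 : 'I_2 => if i0 == 0 then 'X else 1)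
    (z 0 j *: ('X_0 ^+ (n - j) * 'X_1 ^+ j)) =
    \sum_(j < n.+1) (z 0 j)%:P * 'X^(n - j).
  apply: eq_bigr => j _; rewrite mmapZ rmorphM !rmorphXn /= !mmapX !mmap1U /=.
  by rewrite expr1n mulr1.
rewrite coef_sum.
under eq_bigr do rewrite coefCM coefXn.
case: leqP => [le_in | lt_ni].
  have lt_ni : (n - i < n.+1)%N by rewrite ltnS leq_subr.
  rewrite (bigD1 (Ordinal lt_ni)) //= subKn // eqxx mulr1.
  rewrite big1 ?addr0; first by congr (z 0 _); apply: val_inj; rewrite /= inordK.
  move=> j /eqP ne_j; case: eqP => [e|]; last by rewrite mulr0.
  by case: ne_j; apply: val_inj; rewrite /= e subKn // -ltnS.
rewrite big1 // => j _; case: eqP => [e|]; last by rewrite mulr0.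
by move: lt_ni; rewrite e ltnNge leq_subr.
Qed.

(** For a fixed degree n dehomogenization loses nothing: [z_i] is its coefficient of degree n -
    i. *)
Lemma bform_inj n : injective (@bform F n).
Proof.
move=> z z' e; apply/rowP => i.
have := dehom_bform z (n - i); rewrite e dehom_bform leq_subr subKn ?inord_val //.
by rewrite -ltnS.
Qed.

Lemma bform_eq0 n (z : 'rV[F]_n.+1) : (bform z == 0) = (z == 0).
Proof.
have b0 : bform (0 : 'rV[F]_n.+1) = 0.
  by rewrite /bform big1 // => i _; rewrite mxE scale0r.
by apply/eqP/eqP => [e|->//]; apply: bform_inj; rewrite e b0.
Qed.

(* The points of the projective line: [Some t] is (t : 1), [None] is (1 : 0). *)
Definition p1pt P (i : 'I_2) : F :=
  if P is Some t then if i == 0 then t else 1 else (i == 0)%:R.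

Definition hasroot f P := f.@[p1pt P] == 0.

Lemma hasrootM f g P : hasroot (f * g) P = hasroot f P || hasroot g P.
Proof. by rewrite /hasroot mevalM mulf_eq0. Qed.

Lemma meval_bform n (z : 'rV[F]_n.+1) v : (bform z).@[v] =
  \sum_(0 <= i < n.+1) z 0 (inord i) * (v 0 ^+ (n - i) * v 1 ^+ i).
Proof.
rewrite bformE rmorph_sum; apply: eq_bigr => i _ /=.
by rewrite mevalM mevalC mevalM !rmorphXn /= !mevalXU.
Qed.

Lemma bform11 (a0 a1 b0 b1 : F) :
  bform (rowseq 1 [:: a0; a1]) * bform (rowseq 1 [:: b0; b1]) =
  bform (rowseq 2 [:: a0 * b0; a0 * b1 + a1 * b0; a1 * b1]).
Proof. by rewrite !bformE unlock /= !rowseqE //=; ring. Qed.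

Lemma bform12 (a0 a1 b0 b1 b2 : F) :
  bform (rowseq 1 [:: a0; a1]) * bform (rowseq 2 [:: b0; b1; b2]) =
  bform (rowseq 3 [:: a0 * b0; a0 * b1 + a1 * b0; a0 * b2 + a1 * b1; a1 * b2]).
Proof. by rewrite !bformE unlock /= !rowseqE //=; ring. Qed.

Lemma bform22 (a0 a1 a2 b0 b1 b2 : F) :
  bform (rowseq 2 [:: a0; a1; a2]) * bform (rowseq 2 [:: b0; b1; b2]) =
  bform (rowseq 4 [:: a0 * b0; a0 * b1 + a1 * b0; a0 * b2 + a1 * b1 + a2 * b0;
                      a1 * b2 + a2 * b1; a2 * b2]).
Proof. by rewrite !bformE unlock /= !rowseqE //=; ring. Qed.

(** The normalized linear form with root [P]: X - t Y, or Y at infinity. *)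
Definition p1form P : 'rV[F]_2 :=
  rowseq 1 (if P is Some t then [:: 1; - t] else [:: 0; 1]).

Lemma p1form_neq0 P : p1form P != 0.
Proof.
apply/eqP => /rowP; case: P => [t|] /=; first by move/(_ (inord 0)); rewrite rowseqE // mxE => /eqP; rewrite oner_eq0.
by move/(_ (inord 1)); rewrite rowseqE // mxE => /eqP; rewrite oner_eq0.
Qed.

Lemma hasroot_p1form P Q : hasroot (bform (p1form P)) Q = (Q == P).
Proof.
rewrite /hasroot meval_bform unlock /= !rowseqE //.
case: P => [t|]; case: Q => [s|] /=;
  rewrite ?(mul0r, mul1r, mulr1, mulr0, expr0, expr1, addr0, add0r) ?oner_eq0 ?eqxx //.
by rewrite -[_ == Some t]/(s == t) subr_eq0.
Qed.

Lemma linear_form_root (l : 'rV[F]_2) : l != 0 ->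
  exists c P, [/\ c != 0 & l = c *: p1form P].
Proof.
have [[|a [|b []]] // _ ->] := rowseqP l => l_neq0.
have [a0 | a_neq0] := eqVneq a 0.
  have b_neq0 : b != 0.
    apply: contra_neq l_neq0 => b0; apply/rowP => i; rewrite a0 b0 !mxE.
    by case: (val i) => [|[|k]] //=; rewrite nth_nil.
  exists b, None; split=> //; apply/rowP => i; rewrite !mxE a0.
  by case: (val i) => [|[|k]] //=; rewrite ?nth_nil ?mulr0 ?mulr1.
exists a, (Some (- (b / a))); split=> //; apply/rowP => i; rewrite !mxE.
by case: (val i) => [|[|k]] //=; rewrite ?nth_nil ?mulr0 ?mulr1 // opprK mulrC divfK.
Qed.

(** The quotient is given by Horner's scheme, the remainder being the value at [P]; likewise in
    degrees 3 and 4. *)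
Lemma p1form_dvd2 (z : 'rV[F]_3) P : hasroot (bform z) P ->
  exists g : 'rV[F]_2, bform z = bform (p1form P) * bform g.
Proof.
have [[|a [|b [|c []]]] // _ ->] := rowseqP z.
rewrite /hasroot meval_bform unlock /= !rowseqE //=.
case: P => [t|] /=; rewrite ?expr0 ?expr1 ?expr1n ?expr0n ?mulr1 ?mulr0 ?addr0 ?mul1r.
  move=> /eqP e; exists (rowseq 1 [:: a; b + t * a]); rewrite /p1form bform11.
  congr (bform (rowseq _ [:: _; _; _])); first [ring | apply: subr0_eq; rewrite -[RHS]e; ring].
by move=> /eqP ->; exists (rowseq 1 [:: b; c]); rewrite /p1form bform11;
  congr (bform (rowseq _ [:: _; _; _])); ring.
Qed.

Lemma p1form_dvd3 (z : 'rV[F]_4) P : hasroot (bform z) P ->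
  exists g : 'rV[F]_3, bform z = bform (p1form P) * bform g.
Proof.
have [[|a [|b [|c [|d []]]]] // _ ->] := rowseqP z.
rewrite /hasroot meval_bform unlock /= !rowseqE //=.
case: P => [t|] /=; rewrite ?expr0 ?expr1 ?expr1n ?expr0n ?mulr1 ?mulr0 ?addr0 ?mul1r.
  move=> /eqP e; exists (rowseq 2 [:: a; b + t * a; c + t * b + t ^+ 2 * a]).
  rewrite /p1form bform12.
  congr (bform (rowseq _ [:: _; _; _; _])); first [ring | apply: subr0_eq; rewrite -[RHS]e; ring].
by move=> /eqP ->; exists (rowseq 2 [:: b; c; d]); rewrite /p1form bform12;
  congr (bform (rowseq _ [:: _; _; _; _])); ring.
Qed.

Lemma bform13 (a0 a1 b0 b1 b2 b3 : F) :
  bform (rowseq 1 [:: a0; a1]) * bform (rowseq 3 [:: b0; b1; b2; b3]) =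
  bform (rowseq 4 [:: a0 * b0; a0 * b1 + a1 * b0; a0 * b2 + a1 * b1;
                      a0 * b3 + a1 * b2; a1 * b3]).
Proof. by rewrite !bformE unlock /= !rowseqE //=; ring. Qed.

Lemma p1form_dvd4 (z : 'rV[F]_5) P : hasroot (bform z) P ->
  exists g : 'rV[F]_4, bform z = bform (p1form P) * bform g.
Proof.
have [[|a [|b [|c [|d [|k []]]]]] // _ ->] := rowseqP z.
rewrite /hasroot meval_bform unlock /= !rowseqE //=.
case: P => [t|] /=; rewrite ?expr0 ?expr1 ?expr1n ?expr0n ?mulr1 ?mulr0 ?addr0 ?mul1r.
  move=> /eqP e; exists (rowseq 3 [:: a; b + t * a; c + t * b + t ^+ 2 * a;
    d + t * c + t ^+ 2 * b + t ^+ 3 * a]).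
  rewrite /p1form bform13.
  congr (bform (rowseq _ [:: _; _; _; _; _]));
    first [ring | apply: subr0_eq; rewrite -[RHS]e; ring].
by move=> /eqP ->; exists (rowseq 3 [:: b; c; d; k]); rewrite /p1form bform13;
  congr (bform (rowseq _ [:: _; _; _; _; _])); ring.
Qed.

(** A form of positive degree vanishes at the origin, which no invertible polynomial does. *)
Lemma bform_nunit n (z : 'rV[F]_n.+2) : bform z \isn't a GRing.unit.
Proof.
apply/negP => u; have /(congr1 (meval (fun=> 0))) := mulrV u.
rewrite mevalM meval_bform meval1 big1_seq ?mul0r; first by move/eqP; rewrite eq_sym oner_eq0.
move=> i; rewrite mem_index_iota => /andP[_ lt_i].
by rewrite -exprD subnK // expr0n mulr0.
Qed.

Lemma irreducible_bform_noroot n (z : 'rV[F]_n.+3) P :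
  (n <= 2)%N -> irreducible_elt (bform z) -> ~~ hasroot (bform z) P.
Proof.
move=> n2 [_ _ irr]; apply/negP => rP.
have [g e] : exists g : 'rV[F]_n.+2, bform z = bform (p1form P) * bform g.
  case: n n2 z {irr} rP => [|[|[|//]]] _ z.
  - exact: p1form_dvd2.
  - exact: p1form_dvd3.
  - exact: p1form_dvd4.
by case: (irr _ _ e); apply/negP; exact: bform_nunit.
Qed.

Lemma horner_dehom f t : (dehom f).[t] = f.@[p1pt (Some t)].
Proof.
rewrite /dehom /meval /mmap horner_sum; apply: eq_bigr => m _.
rewrite hornerM hornerC /= /mmap1 horner_prod; congr (_ * _); apply: eq_bigr => i _.
by rewrite horner_exp /=; case: ifP => _; rewrite ?hornerX ?hornerC.
Qed.

Lemma size_dehom f : (size (dehom f) <= msize f)%N.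
Proof.
rewrite /dehom /mmap; apply: leq_trans (size_sum _ _ _) _.
apply/bigmax_leqP_seq => m /msize_mdeg_lt lt_m _; apply: leq_trans lt_m.
rewrite mul_polyC; apply: leq_trans (size_scale_leq _ _) _.
rewrite /mmap1 !big_ord_recl big_ord0 /= expr1n !mulr1 size_polyXn ltnS.
by rewrite mdegE big_ord_recl leq_addr.
Qed.

Lemma msize_bform n (z : 'rV[F]_n.+1) : (msize (bform z) <= n.+1)%N.
Proof.
rewrite /bform; apply: leq_trans (msize_sum _ _ _) _.
apply/bigmax_leqP => i _; apply: leq_trans (msizeZ_le _ _) _.
rewrite !mpolyXn -mpolyXD msizeX mdegD !mdegMn !mdeg1 !mul1n subnK //.
by rewrite -ltnS.
Qed.

(** A factor that is constant in X could still involve Y. But here the cofactor already has the full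
    degree n in X, so no total degree is left for [g]. *)
Lemma dehom_const_unit n (z : 'rV[F]_n.+1) g h : z != 0 -> bform z = g * h ->
  size (dehom (bform z)) = n.+1 -> size (dehom g) = 1%N -> g \is a GRing.unit.
Proof.
move=> z0 e sz sg.
have gh0 : g * h != 0 by rewrite -e bform_eq0.
have [g0 h0] : g != 0 /\ h != 0 by apply/andP; rewrite -negb_or -mulf_eq0.
have dg0 : dehom g != 0 by rewrite -size_poly_eq0 sg.
have dh0 : dehom h != 0.
  by apply: contra_eq_neq sz => dh0; rewrite e dehomM dh0 mulr0 size_poly0.
have sh : size (dehom h) = n.+1.
  by move: sz; rewrite e dehomM size_mul // sg.
have := msize_bform z; rewrite e msizeM // => le_n.
have le_h := size_dehom h; rewrite sh in le_h.
have g1 : (msize g <= 1)%N.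
  rewrite -(leq_add2r n.+1) add1n; case: (msize g) (msize h) le_n le_h => [|a] [|b] //=.
  by rewrite !addSn !addnS /= ltnS => ab nb; rewrite ltnS; apply: leq_trans ab; rewrite leq_add2l.
move: (msize1_polyC g1) g0 => ->; rewrite mpolyC_eq0 -unitfE => u.
by rewrite rmorph_unit.
Qed.

(* Dehomogenizing at a point at infinity which is not a root keeps the degree,
   so that a factorization into non-units has a linear factor in one variable. *)
Lemma noroot_irreducible n (z : 'rV[F]_n.+1) : (0 < n <= 3)%N ->
  (forall P, ~~ hasroot (bform z) P) -> irreducible_elt (bform z).
Proof.
case: n z => // n z n3 nr.
have lead : z 0 (inord 0) != 0.
  have := nr None; rewrite /hasroot meval_bform big_nat_recl // big1 => [|i _].
    by rewrite /= expr1n !mulr1 addr0.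
  by rewrite /= expr0n /= !mulr0.
have z0 : z != 0 by apply: contraNneq lead => ->; rewrite mxE.
have sz : size (dehom (bform z)) = n.+2.
  apply/eqP; rewrite eqn_leq (leq_trans (size_dehom _) (msize_bform _)) /=.
  by rewrite ltnNge; apply/negP => /leq_sizeP/(_ n.+1 (leqnn _))/eqP;
    rewrite dehom_bform leqnn subnn (negPf lead).
split; [by rewrite bform_eq0 | exact: bform_nunit |].
move=> g h e.
have [dg0 dh0] : dehom g != 0 /\ dehom h != 0.
  by apply/andP; rewrite -negb_or -mulf_eq0 -dehomM -e -size_poly_eq0 sz.
have szM := sz; rewrite e dehomM size_mul // in szM.
have nr1 p q : dehom (bform z) = p * q -> size p != 2.
  move=> pq; apply/eqP => /poly2_root[t]; rewrite /root => pt0.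
  by have := nr (Some t); rewrite /hasroot -horner_dehom pq hornerM mulf_eq0 pt0.
have sg2 := nr1 _ _ (etrans (congr1 dehom e) (dehomM g h)).
have sh2 := nr1 _ _ (etrans (congr1 dehom (etrans e (mulrC g h))) (dehomM h g)).
move: dg0 dh0; rewrite -!size_poly_gt0.
case sgE: (size (dehom g)) szM sg2 => [|[|[|a]]] // szM _ _.
  by left; apply: dehom_const_unit e sz sgE.
case shE: (size (dehom h)) szM sh2 => [|[|[|b]]] //.
  by right; apply: dehom_const_unit (etrans e (mulrC g h)) sz shE.
by rewrite !addSn !addnS /= => -[nE]; move: n3; rewrite -nE !ltnS.
Qed.

End BinaryForms.

(** * Squares in a finite field of characteristic 3 *)

Lemma natr_mul3 (R : pzRingType) (n : nat) : 3%:R = 0 :> R -> (3 * n)%:R = 0 :> R.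
Proof. by move=> h; rewrite natrM h mul0r. Qed.

Lemma oppr_natr_mul3 (R : pzRingType) (n : nat) : 3%:R = 0 :> R -> - (3 * n)%:R = 0 :> R.
Proof. by move=> h; rewrite natr_mul3 ?oppr0. Qed.

(* [ring: h] only cancels coefficients that are equal to the one in [h]. *)
Ltac ring3 h := apply: subr0_eq;
  ring: (natr_mul3 1 h) (natr_mul3 2 h) (natr_mul3 3 h) (natr_mul3 4 h)
        (natr_mul3 5 h) (natr_mul3 6 h) (natr_mul3 7 h) (natr_mul3 8 h)
        (oppr_natr_mul3 1 h) (oppr_natr_mul3 2 h) (oppr_natr_mul3 3 h)
        (oppr_natr_mul3 4 h) (oppr_natr_mul3 5 h) (oppr_natr_mul3 6 h)
        (oppr_natr_mul3 7 h) (oppr_natr_mul3 8 h).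

Section Squares.
Variable F : finFieldType.
Hypothesis char3 : 3%:R = 0 :> F.

(** Zero counts as a square, so that a non-square is automatically non-zero. *)
Definition issq (a : F) := [exists x, x ^+ 2 == a].

Definition quadchar (a : F) : int :=
  if a == 0 then 0 else if issq a then 1 else -1.

Lemma issqP a : reflect (exists x, a = x ^+ 2) (issq a).
Proof. by apply: (iffP existsP) => -[x]; [move/eqP <-|move->]; exists x. Qed.

Lemma issq_sqr x : issq (x ^+ 2).
Proof. by apply/issqP; exists x. Qed.

Lemma issqM a x : x != 0 -> issq (a * x ^+ 2) = issq a.
Proof.
move=> x0; apply/issqP/issqP => -[y e]; last by exists (y * x); rewrite e exprMn.
by exists (y / x); rewrite expr_div_n -e mulfK // expf_neq0.
Qed.

Lemma quadcharM a x : x != 0 -> quadchar (a * x ^+ 2) = quadchar a.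
Proof.
by move=> x0; rewrite /quadchar issqM // mulf_eq0 expf_eq0 (negPf x0) orbF.
Qed.

(** Since 3 = 0, doubling is negation, so [- x = x] forces [x = 0]. *)
Lemma opp_neq x : x != 0 -> - x != x :> F.
Proof.
move=> x0; apply: contra_neq x0 => e.
by have -> : x = 3%:R * x - (x - - x) by [ring]; rewrite char3 mul0r e subrr subr0.
Qed.

Lemma card_sqrt a : (#|[set x | x ^+ 2 == a]|%:R : int) = 1 + quadchar a.
Proof.
rewrite /quadchar; have [-> | a0] := eqVneq a 0.
  suff -> : [set x : F | x ^+ 2 == 0] = [set 0] by rewrite cards1 addr0.
  by apply/setP => x; rewrite !inE expf_eq0.
case: issqP => [[x e] | no].
  have x0 : x != 0 by apply: contra_neq a0; rewrite e => ->; rewrite expr0n.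
  suff -> : [set y | y ^+ 2 == a] = [set x; - x].
    by rewrite cards2 eq_sym opp_neq.
  by apply/setP => y; rewrite !inE e eqf_sqr.
suff -> : [set y | y ^+ 2 == a] = set0 by rewrite cards0 subrr.
by apply/setP => y; rewrite !inE; apply/eqP => e; case: no; exists y.
Qed.

(** Counting fibre by fibre turns the number of points of w^2 = G into a character sum. *)
Lemma sum_card_sqrt (I : finType) (G : I -> F) :
  (#|[set p : I * F | p.2 ^+ 2 == G p.1]|%:R : int) = \sum_i (1 + quadchar (G i)).
Proof.
under eq_bigr do rewrite -card_sqrt.
rewrite -natr_sum; congr _%:R.
rewrite -sum1dep_card; under [RHS]eq_bigr do rewrite -sum1dep_card.
by rewrite pair_big_dep.
Qed.

(** The curve x^2 = a has exactly one point for each x; compare with the count over a. *)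
Lemma sum_quadchar : \sum_a quadchar a = 0.
Proof.
have := sum_card_sqrt id; rewrite big_split /= sumr_const -[#|_|]/#|F|.
suff -> : #|[set p : F * F | p.2 ^+ 2 == p.1]| = #|F|.
  by move=> /(congr1 (fun z => z - #|F|%:R)); rewrite subrr addrAC subrr add0r.
rewrite -[RHS](card_imset predT (f := fun x : F => (x ^+ 2, x))) => [|x y [] //].
apply: eq_card => -[a x]; rewrite !inE /=; apply/eqP/imsetP => [<-|[y _ [-> ->]] //].
by exists x.
Qed.

(** By [sum_quadchar] there are as many non-zero squares as non-squares. Multiplication by [a] maps
    the former injectively into the latter, hence onto, so [b] is [a] times a square. *)
Lemma issqM_nonsq a b : ~~ issq a -> ~~ issq b -> issq (a * b).
Proof.
move=> na nb.
have nz c : ~~ issq c -> c != 0.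
  by apply: contraNneq => ->; apply/issqP; exists 0; rewrite expr0n.
pose Q := [set c | (c != 0) && issq c]; pose N := [set c | ~~ issq c].
have eQN : #|Q| = #|N|.
  apply/eqP; rewrite -(eqr_nat int) -subr_eq0; apply/eqP.
  rewrite -[RHS]sum_quadchar -!sum1dep_card !natr_sum.
  rewrite [RHS](bigD1 0) //= {1}/quadchar eqxx add0r.
  rewrite [RHS](bigID issq) /= -sumrN; congr (_ + _).
    by apply: eq_bigr => c /andP[c0 sc]; rewrite /quadchar (negPf c0) sc.
  apply: eq_big => [c | c nc]; first by rewrite andb_idl // => /nz.
  by rewrite /quadchar (negPf (nz _ nc)) (negPf nc).
have sub : [set a * c | c in Q] \subset N.
  apply/subsetP => _ /imsetP[c + ->]; rewrite !inE => /andP[c0 /issqP[x e]].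
  rewrite e issqM //; apply: contra_neq c0; rewrite e => ->; by rewrite expr0n.
have eN : [set a * c | c in Q] = N.
  apply/eqP; rewrite eqEcard sub card_imset ?eQN ?leqnn //.
  exact: (mulfI (nz _ na)).
have : b \in N by rewrite inE.
rewrite -eN => /imsetP[c]; rewrite inE => /andP[_ /issqP[x ->]] ->.
by apply/issqP; exists (a * x); ring.
Qed.

(* For A a non-square, y -> y^3 - A y is additive in characteristic 3 with trivial
   kernel. *)
Lemma artin_schreier_nonsq A B : ~~ issq A -> exists y, y ^+ 3 - A * y = B.
Proof.
move=> nA; have inj : injective (fun y : F => y ^+ 3 - A * y).
  move=> x y /= e; apply/eqP; rewrite -subr_eq0; apply/negPn/negP => d0.
  have : (x - y) * ((x - y) ^+ 2 - A) = 0.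
    have -> : (x - y) * ((x - y) ^+ 2 - A) = (x ^+ 3 - A * x) - (y ^+ 3 - A * y).
      by ring3 char3.
    by rewrite e subrr.
  move/eqP; rewrite mulf_eq0 (negPf d0) subr_eq0 => /eqP eA.
  by case/issqP: nA; exists (x - y).
by have [g _ gK] := injF_bij inj; exists (g B).
Qed.
End Squares.

(** * Binary cubic forms *)

Section Cubics.
Variable F : finFieldType.
Hypothesis char3 : 3%:R = 0 :> F.
Implicit Types (f g h : {mpoly F[2]}) (P Q R : option F).

Definition p1roots f : {set option F} := [set P | hasroot f P].

Lemma p1rootsM f g : p1roots (f * g) = p1roots f :|: p1roots g.
Proof. by apply/setP => P; rewrite !inE hasrootM. Qed.

Lemma p1rootsZ (c : F) f : c != 0 -> p1roots (c *: f) = p1roots f.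
Proof. by move=> c0; apply/setP => P; rewrite !inE /hasroot mevalZ mulf_eq0 (negPf c0). Qed.

Lemma p1roots_p1form P : p1roots (bform (p1form P)) = [set P].
Proof. by apply/setP => Q; rewrite !inE hasroot_p1form. Qed.

Lemma free2_p1form (c d : F) P Q :
  free [:: c *: p1form P; d *: p1form Q] = [&& c != 0, d != 0 & P != Q].
Proof.
rewrite free_cons seq1_free span_seq1 scaler_eq0 negb_or p1form_neq0 andbT.
have [-> | d0] := eqVneq d 0; first by rewrite !andbF.
rewrite /= andbT; have [-> | c0] := eqVneq c 0; first by rewrite scale0r mem0v.
congr (~~ _); apply/idP/eqP => [/vlineP[k e] | ->]; last first.
  by apply/vlineP; exists (c / d); rewrite scalerA divfK.
have k0 : k * d != 0.
  apply: contraTneq (p1form_neq0 P) => kd; rewrite negbK.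
  have : c *: p1form P == 0 by rewrite e scalerA kd scale0r.
  by rewrite scaler_eq0 (negPf c0).
have := p1roots_p1form P; rewrite -(p1rootsZ _ c0) -bformZ e scalerA bformZ p1rootsZ //.
by rewrite p1roots_p1form => /set1_inj.
Qed.

(* The discriminant of a binary cubic form; the terms divisible by 3 are dropped. *)
Definition disc3 (z : 'rV[F]_4) : F :=
  z 0 (inord 1) ^+ 2 * z 0 (inord 2) ^+ 2 - z 0 (inord 0) * z 0 (inord 2) ^+ 3
  - z 0 (inord 1) ^+ 3 * z 0 (inord 3).

(** The usual b^2 - 4 a c, where 4 = 1. *)
Definition disc2 (z : 'rV[F]_3) : F :=
  z 0 (inord 1) ^+ 2 - z 0 (inord 0) * z 0 (inord 2).

Lemma disc2Z c z : disc2 (c *: z) = c ^+ 2 * disc2 z.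
Proof. by rewrite /disc2 !mxE; ring. Qed.

Lemma disc2_mul P (l : 'rV[F]_2) (g : 'rV[F]_3) :
  bform g = bform (p1form P) * bform l -> disc2 g = (bform l).@[p1pt P] ^+ 2.
Proof.
have [[|a [|b []]] // _ ->] := rowseqP l.
rewrite /p1form meval_bform unlock /= !rowseqE //=.
case: P => [t|]; rewrite bform11 => /bform_inj ->; rewrite /disc2 !rowseqE //=.
  by rewrite ?expr0 ?expr1; ring3 char3.
by ring.
Qed.

(** The rule disc(l g) = disc(g) Res(l, g)^2: up to sign, the resultant with [p1form P] is the value
    at [P]. *)
Lemma disc3_mul P (g : 'rV[F]_3) (z : 'rV[F]_4) :
  bform z = bform (p1form P) * bform g ->
  disc3 z = disc2 g * (bform g).@[p1pt P] ^+ 2.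
Proof.
have [[|a [|b [|c []]]] // _ ->] := rowseqP g.
rewrite /p1form meval_bform unlock /= !rowseqE //=.
case: P => [t|]; rewrite bform12 => /bform_inj ->; rewrite /disc3 /disc2 !rowseqE //=.
  by rewrite ?expr0 ?expr1; ring3 char3.
by ring.
Qed.

Lemma disc2_issq_root (g : 'rV[F]_3) :
  issq (disc2 g) = [exists P, hasroot (bform g) P].
Proof.
apply/idP/existsP => [/issqP[s]|[P /p1form_dvd2[l /disc2_mul ->]]]; last exact: issq_sqr.
rewrite /hasroot /disc2 => e.
have [a0 | a0] := eqVneq (g 0 (inord 0)) 0.
  by exists None; rewrite meval_bform unlock /= a0; apply/eqP; ring.
(* The quadratic formula (- b + s) / (2 a), where 2 = -1. *)
exists (Some ((g 0 (inord 1) - s) / g 0 (inord 0))).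
rewrite meval_bform unlock /=; apply/eqP.
set a := g 0 _ in a0 e *; set b := g 0 _ in e *; set c := g 0 _ in e *.
have -> : a * (((b - s) / a) ^+ 2 * 1 ^+ 0) +
  (b * (((b - s) / a) ^+ 1 * 1 ^+ 1) + (c * (((b - s) / a) ^+ 0 * 1 ^+ 2) + 0)) =
  3 * (b ^+ 2 - b * s) / a + (s ^+ 2 - (b ^+ 2 - a * c)) / a by field.
by rewrite e char3 !mul0r subrr mul0r addr0.
Qed.

Lemma disc3_nonsq_root (z : 'rV[F]_4) :
  ~~ issq (disc3 z) -> exists P, hasroot (bform z) P.
Proof.
have [[|a [|b [|c [|d []]]]] // _ ->] := rowseqP z.
rewrite /disc3 !rowseqE //= => nD.
have D0 : b ^+ 2 * c ^+ 2 - a * c ^+ 3 - b ^+ 3 * d != 0.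
  by apply: contraNneq nD => ->; apply/issqP; exists 0; rewrite expr0n.
have [a0 | a0] := eqVneq a 0.
  exists None; rewrite /hasroot meval_bform unlock /= !rowseqE //= a0.
  by apply/eqP; ring.
have [b0 | b0] := eqVneq b 0.
  rewrite b0 in nD D0.
  have c0 : c != 0 by apply: contraNneq D0 => ->; apply/eqP; ring.
  (* Dividing by [a] already gives y^3 - A y - B, with A = - c / a; the discriminant is A (a
     c)^2. *)
  have [|y e] := @artin_schreier_nonsq F char3 (- (c / a)) (- (d / a)).
    rewrite -(issqM _ (mulf_neq0 a0 c0)); congr (~~ issq _): nD.
    by field.
  exists (Some y); rewrite /hasroot meval_bform unlock /= !rowseqE //= b0.
  apply/eqP; transitivity (a * (y ^+ 3 - - (c / a) * y - - (d / a))); first by field.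
  by rewrite e subrr mulr0.
move: nD D0; set D := _ - _ => nD D0.
(* Translating by [c / b] removes the linear term and leaves the constant term - D / b^3. Replacing
   the variable by 1 / y then gives y^3 - (b^4 / D) y - a b^3 / D. *)
have [|y e] := @artin_schreier_nonsq F char3 (b ^+ 4 / D) (a * b ^+ 3 / D).
  have bD : b ^+ 2 / D != 0 by rewrite mulf_neq0 ?invr_eq0 ?expf_neq0.
  by rewrite -(issqM _ bD) in nD; congr (~~ issq _): nD; field.
have y0 : y != 0.
  apply: contra_eq_neq e => ->; rewrite expr0n /= mulr0 subr0 eq_sym.
  by rewrite !mulf_neq0 ?invr_eq0 ?expf_neq0.
exists (Some (y^-1 + c / b)); rewrite /hasroot meval_bform unlock /= !rowseqE //=.
apply/eqP.
transitivity (- (D / b ^+ 3 / y ^+ 3) * (y ^+ 3 - b ^+ 4 / D * y - a * b ^+ 3 / D)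
  + 3 * (a * (c / b) / y * (c / b + 1 / y) + c / y + c ^+ 2 / b)); last by rewrite e subrr char3; ring.
by rewrite /D; field; rewrite b0 y0 exprMn.
Qed.

End Cubics.

(** * Classes of binary cubics by discriminant and number of roots *)

Section CubicClasses.
Variable F : finFieldType.
Hypothesis char3 : 3%:R = 0 :> F.
Implicit Types (f g h : {mpoly F[2]}) (P Q R : option F).

Definition N1form f := exists l : 'rV[F]_2, f = bform l ^+ 3.
Definition N2form f := exists l1 l2 : 'rV[F]_2,
  free [:: l1; l2] /\ f = bform l1 ^+ 2 * bform l2.
Definition N3form f := exists l1 l2 l3 : 'rV[F]_2,
  [/\ free [:: l1; l2], free [:: l1; l3], free [:: l2; l3]
    & f = bform l1 * bform l2 * bform l3].
Definition N4form f := exists (l : 'rV[F]_2) (g : 'rV[F]_3),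
  irreducible_elt (bform g) /\ f = bform l * bform g.

(** In characteristic 3, (u X + v Y)^3 = u^3 X^3 + v^3 Y^3, so a non-zero middle coefficient
    excludes multiples of cubes. *)
Definition noncube (z : 'rV[F]_4) := (z 0 (inord 1) != 0) || (z 0 (inord 2) != 0).

Lemma noncubeP (z : 'rV[F]_4) c (l : 'rV[F]_2) : noncube z -> bform z <> c *: bform l ^+ 3.
Proof.
have [[|a [|b []]] // _ ->] := rowseqP l => nc e; move: nc.
rewrite exprS expr2 bform11 bform12 -bformZ in e; move/bform_inj: e ->.
rewrite /noncube !mxE !inordK //=.
set u := c * _; set v := c * _.
have -> : u = 0 by rewrite /u; ring3 char3.
have -> : v = 0 by rewrite /v; ring3 char3.
by rewrite eqxx.
Qed.

Lemma noncube_neq0 (z : 'rV[F]_4) : noncube z -> z != 0.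
Proof. by apply: contraTneq => ->; rewrite /noncube !mxE eqxx. Qed.

Lemma free2_linear (l1 l2 : 'rV[F]_2) : free [:: l1; l2] ->
  exists c d P Q, [/\ l1 = c *: p1form P, l2 = d *: p1form Q, c != 0, d != 0 & P != Q].
Proof.
move=> fr; have : l1 != 0 by apply: (free_not0 fr); rewrite !inE eqxx.
have : l2 != 0 by apply: (free_not0 fr); rewrite !inE eqxx orbT.
move=> /linear_form_root[d [Q [d0 e2]]] /linear_form_root[c [P [c0 e1]]].
exists c, d, P, Q; split=> //; move: fr; rewrite e1 e2 free2_p1form.
by case/and3P.
Qed.

(** After one copy of the double factor is split off, the remaining quadratic still vanishes at its
    root, so [disc3_mul] gives zero. *)
Lemma N2form_disc (z : 'rV[F]_4) : N2form (bform z) ->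
  disc3 z = 0 /\ #|p1roots (bform z)| = 2%N.
Proof.
case=> l1 [l2 [/free2_linear[c [d [P [Q [-> -> c0 d0 PQ]]]]] e]]; split; last first.
  by rewrite e expr2 !p1rootsM !bformZ !p1rootsZ // !p1roots_p1form setUid cards2 PQ.
have [g eg] : exists g : 'rV[F]_3,
    bform g = bform (p1form P) * bform (c ^+ 2 *: (d *: p1form Q)).
  move: (_ *: (_ *: _)) => l.
  have [[|a [|b []]] // _ ->] := rowseqP l; case: P {e PQ} => [t|];
  by rewrite /p1form bform11; eexists.
have -> : disc3 z = disc2 g * (bform g).@[p1pt P] ^+ 2.
  apply: disc3_mul => //; rewrite e eg !bformZ expr2 -!mul_mpolyC.
  by rewrite !rmorphXn /=; ring.
have /eqP -> : hasroot (bform g) P by rewrite eg hasrootM hasroot_p1form eqxx.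
by rewrite expr0n mulr0.
Qed.

Lemma mul_linear (l l' : 'rV[F]_2) :
  exists z : 'rV[F]_3, bform z = bform l * bform l'.
Proof.
have [[|a [|b []]] // _ ->] := rowseqP l.
have [[|a' [|b' []]] // _ ->] := rowseqP l'.
by rewrite bform11; eexists.
Qed.

(** In characteristic 3 the derivative is c - b x, so the double root is rational: [c / b], or
    infinity when b = 0. The third root is different, as the form is not a multiple of a cube. *)
Lemma disc3_eq0_N2form (z : 'rV[F]_4) :
  noncube z -> disc3 z = 0 -> N2form (bform z).
Proof.
move=> nc D0.
have [P [l e]] : exists P (l : 'rV[F]_2), bform z = bform (p1form P) ^+ 2 * bform l.
  move: nc D0; have [[|a [|b [|c [|d []]]]] // _ ->] := rowseqP z.
  rewrite /noncube /disc3 !rowseqE //=; have [-> /= c0 D0 | b0 _ D0] := eqVneq b 0.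
    exists None, (rowseq 1 [:: c; d]).
    rewrite expr2 -mulrA bform11 bform12; congr (bform (rowseq _ [:: _; _; _; _])); try ring.
    apply: (mulfI (expf_neq0 3 c0)); transitivity (- (0 ^+ 2 * c ^+ 2 - a * c ^+ 3 - 0 ^+ 3 * d)); first by ring.
    by rewrite D0; ring.
  have [k ck] : exists k, c = b * k by exists (c / b); rewrite mulrC divfK.
  have dk : d = b * k ^+ 2 - a * k ^+ 3.
    apply: (mulfI (expf_neq0 3 b0)); rewrite ck in D0.
    transitivity (b ^+ 3 * (b * k ^+ 2 - a * k ^+ 3) -
      (b ^+ 2 * (b * k) ^+ 2 - a * (b * k) ^+ 3 - b ^+ 3 * d)); first by ring.
    by rewrite D0 subr0.
  exists (Some k), (rowseq 1 [:: a; b - a * k]).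
  rewrite ck dk expr2 -mulrA bform11 bform12.
  by congr (bform (rowseq _ [:: _; _; _; _])); ring3 char3.
have l0 : l != 0.
  by apply: contraTneq (noncube_neq0 nc) => l0; rewrite negbK -bform_eq0 e mulf_eq0 orbC bform_eq0 l0 eqxx.
have [c [Q [c0 el]]] := linear_form_root l0; rewrite el in e.
exists (p1form P), (c *: p1form Q); split=> //.
rewrite -[p1form P]scale1r free2_p1form oner_eq0 c0 /=.
apply/eqP => PQ; apply: (noncubeP (c := c) (l := p1form P) nc).
by rewrite e PQ bformZ -scalerAr -exprSr.
Qed.

(** For a completely split cubic the discriminant is the square of the product of the pairwise
    resultants. *)
Lemma disc3_p1form P Q (l : 'rV[F]_2) (z : 'rV[F]_4) :
  bform z = bform (p1form P) * (bform (p1form Q) * bform l) ->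
  disc3 z = ((bform l).@[p1pt Q] * (bform (p1form Q) * bform l).@[p1pt P]) ^+ 2.
Proof.
have [g eg] := mul_linear (p1form Q) l; rewrite -eg => /(disc3_mul char3) ->.
by rewrite (disc2_mul char3 eg) exprMn.
Qed.

Lemma N3form_disc (z : 'rV[F]_4) : N3form (bform z) ->
  [/\ disc3 z != 0, issq (disc3 z) & #|p1roots (bform z)| = 3%N].
Proof.
case=> l1 [l2 [l3 [/free2_linear[c [d [P [Q [-> -> c0 d0 PQ]]]]] fr1 fr2 e]]].
have l30 : l3 != 0 by apply: (free_not0 fr1); rewrite !inE eqxx orbT.
have [k [R [k0 el]]] := linear_form_root l30.
have PR : P != R by move: fr1; rewrite el free2_p1form => /and3P[].
have QR : Q != R by move: fr2; rewrite el free2_p1form => /and3P[].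
have -> : disc3 z = ((bform (c * d * k *: p1form R)).@[p1pt Q] *
    (bform (p1form Q) * bform (c * d * k *: p1form R)).@[p1pt P]) ^+ 2.
  apply: disc3_p1form; rewrite e el !bformZ -!mul_mpolyC !rmorphM /=; ring.
split; [|exact: issq_sqr|].
- rewrite expf_neq0 // mevalM mulf_neq0 ?mulf_neq0 //.
  + by rewrite bformZ mevalZ mulf_neq0 ?mulf_neq0 // -[_ != 0]/(~~ hasroot _ _) hasroot_p1form.
  + by rewrite -[_ != 0]/(~~ hasroot _ _) hasroot_p1form.
  + by rewrite bformZ mevalZ mulf_neq0 ?mulf_neq0 // -[_ != 0]/(~~ hasroot _ _) hasroot_p1form.
- rewrite e el !p1rootsM !bformZ !p1rootsZ // !p1roots_p1form.
  by rewrite setUC cardsU1 cards2 !inE negb_or ![R == _]eq_sym PQ PR QR.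
Qed.

(** The discriminant is that of the irreducible quadratic, a non-square since there is no root,
    times a non-zero square. *)
Lemma N4form_disc (z : 'rV[F]_4) : noncube z -> N4form (bform z) ->
  ~~ issq (disc3 z) /\ #|p1roots (bform z)| = 1%N.
Proof.
move=> nc [l [g [irr e]]].
have nr P : ~~ hasroot (bform g) P by exact: irreducible_bform_noroot.
have l0 : l != 0.
  by apply: contraTneq (noncube_neq0 nc) => l0; rewrite negbK -bform_eq0 e mulf_eq0 bform_eq0 l0 eqxx.
have [c [P [c0 el]]] := linear_form_root l0.
have rg : p1roots (bform g) = set0 by apply/setP => Q; rewrite !inE (negPf (nr Q)).
split; last by rewrite e el p1rootsM rg setU0 bformZ p1rootsZ // p1roots_p1form cards1.
have -> : disc3 z = disc2 g * (c ^+ 2 * (bform g).@[p1pt P]) ^+ 2.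
  transitivity (disc2 (c *: g) * (bform (c *: g)).@[p1pt P] ^+ 2).
    by apply: (disc3_mul char3); rewrite e el !bformZ -scalerAl -scalerAr.
  by rewrite disc2Z bformZ mevalZ; ring.
rewrite issqM ?mulf_neq0 ?expf_neq0 //; last exact: (nr P).
rewrite disc2_issq_root //; apply/existsP => -[Q]; exact/negP.
Qed.

Lemma N5form_roots (z : 'rV[F]_4) :
  irreducible_elt (bform z) -> #|p1roots (bform z)| = 0%N.
Proof.
move=> irr; apply/eqP; rewrite cards_eq0; apply/eqP/setP => P; rewrite !inE.
exact/negbTE/irreducible_bform_noroot.
Qed.

(** The discriminant is zero on N_2, a non-square on N_4 and a non-zero square on N_3 and N_5. In
    the last case one rational root forces three, because the quadratic cofactor then has square
    discriminant. *)
Lemma cubic_classes (z : 'rV[F]_4) : noncube z ->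
  [/\ ~ N1form (bform z), N2form (bform z) <-> disc3 z = 0,
      N3form (bform z) <-> #|p1roots (bform z)| = 3%N,
      N4form (bform z) <-> ~~ issq (disc3 z)
    & irreducible_elt (bform z) <-> #|p1roots (bform z)| = 0%N] /\
  (#|p1roots (bform z)| = if disc3 z == 0 then 2%N else if issq (disc3 z)
     then (if #|p1roots (bform z)| == 0 then 0%N else 3%N) else 1%N).
Proof.
move=> nc.
have no1 : ~ N1form (bform z).
  by case=> l e; apply: (noncubeP (c := 1) (l := l) nc); rewrite scale1r.
have [D0 | D0] := eqVneq (disc3 z) 0.
  have n2 := disc3_eq0_N2form nc D0; have [_ R2] := N2form_disc n2.
  have sq : issq (disc3 z) by rewrite D0; apply/issqP; exists 0; rewrite expr0n.
  rewrite sq R2; split=> //; split=> //; split=> //.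
  - by move/N3form_disc; rewrite D0 eqxx => -[].
  - by move/(N4form_disc nc); rewrite sq => -[].
  - by move/N5form_roots; rewrite R2.
have no2 : ~ N2form (bform z) by move/N2form_disc => -[/eqP]; rewrite (negPf D0).
case sq: (issq (disc3 z)); last first.
  have [P /p1form_dvd3[g e]] := disc3_nonsq_root char3 (negbT sq).
  have n4 : N4form (bform z).
    exists (p1form P), g; split=> //; apply: noroot_irreducible => // Q.
    apply: contraFN sq => rQ; rewrite (disc3_mul char3 e).
    have sg : issq (disc2 g) by rewrite disc2_issq_root //; apply/existsP; exists Q.
    by have /issqP[s ->] := sg; rewrite -exprMn issq_sqr.
  have [_ R1] := N4form_disc nc n4.
  rewrite R1; split=> //; split=> //; split=> //; try by move=> ?.
  - by move/eqP; rewrite (negPf D0).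
  - by move/N3form_disc; rewrite sq => -[].
  - by move/N5form_roots; rewrite R1.
have no4 : ~ N4form (bform z) by move/(N4form_disc nc); rewrite sq => -[].
have [R0 | [P rP]] := set_0Vmem (p1roots (bform z)).
  have irr : irreducible_elt (bform z).
    by apply: noroot_irreducible => // P; apply/negP => rP; have := in_set0 P; rewrite -R0 inE rP.
  rewrite R0 cards0; split=> //; split=> //; split=> //.
  - by move/eqP; rewrite (negPf D0).
  - by move/N3form_disc; rewrite R0 cards0 => -[].
have [g eg] : exists g : 'rV[F]_3, bform z = bform (p1form P) * bform g.
  by apply: p1form_dvd3; rewrite inE in rP.
have n3 : N3form (bform z).
  have [Q rQ] : exists Q, hasroot (bform g) Q.
    apply/existsP; rewrite -(disc2_issq_root char3); move: sq D0.
    rewrite (disc3_mul char3 eg) mulf_eq0 expf_eq0 negb_or => sq /andP[_ gP].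
    by rewrite issqM in sq.
  have [l el] := p1form_dvd2 rQ.
  have l0 : l != 0.
    by apply: contraTneq (noncube_neq0 nc) => l0; rewrite negbK -bform_eq0 eg el !mulf_eq0 !bform_eq0 l0 eqxx !orbT.
  have [c [R [c0 ec]]] := linear_form_root l0.
  rewrite el in eg; have D := disc3_p1form eg.
  move: D0; rewrite D expf_eq0 /= mevalM ec bformZ !mevalZ !mulf_eq0 (negPf c0) /= !negb_or.
  rewrite -![_ == 0]/(hasroot _ _) !hasroot_p1form => /and3P[QR PQ PR].
  exists (p1form P), (p1form Q), (c *: p1form R); split; last by rewrite eg ec mulrA.
  - by rewrite -[p1form P]scale1r -[p1form Q]scale1r free2_p1form oner_eq0 PQ.
  - by rewrite -[p1form P]scale1r free2_p1form oner_eq0 c0 PR.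
  - by rewrite -[p1form Q]scale1r free2_p1form oner_eq0 c0 QR.
have [_ _ R3] := N3form_disc n3.
rewrite R3; split=> //; split=> //; split=> //.
- by move/eqP; rewrite (negPf D0).
- by move/N5form_roots; rewrite R3.
Qed.

End CubicClasses.

(** * The character sum of a quartic *)

Section QuarticCharacterSum.
Variable F : finFieldType.
Hypothesis char3 : 3%:R = 0 :> F.
Implicit Types a b c d e h k t u v w x y : F.

Definition quartic_disc z0 z1 z2 z3 z4 : F :=
  (z0 * z4 - z1 * z3) ^+ 3 + (z0 * z4 - z1 * z3) ^+ 2 * z2 ^+ 2
  - z2 ^+ 3 * (z0 * z3 ^+ 2 + z4 * z1 ^+ 2 - z0 * z2 * z4).

Definition quartic z0 z1 z2 z3 z4 x : F :=
  z0 * x ^+ 4 + z1 * x ^+ 3 + z2 * x ^+ 2 + z3 * x + z4.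

(** The leading coefficient is the value at infinity: this is a sum over the projective line. *)
Definition quartic_sum z0 z1 z2 z3 z4 : int :=
  quadchar z0 + \sum_x quadchar (quartic z0 z1 z2 z3 z4 x).

(** The parameter [t] stands for 1/r. *)
Definition elliptic_sum t : int := \sum_y quadchar (y ^+ 3 + y ^+ 2 - t).

(** These are the coefficients of f(x + c), binomial coefficients being reduced modulo 3; the
    coefficient of x^2 does not change. *)
Lemma quartic_disc_translate z0 z1 z2 z3 z4 c :
  quartic_disc z0 (z1 + z0 * c) z2 (z3 + z0 * c ^+ 3 - z2 * c)
    (quartic z0 z1 z2 z3 z4 c) = quartic_disc z0 z1 z2 z3 z4.
Proof. by rewrite /quartic_disc /quartic; ring3 char3. Qed.

Lemma quartic_disc_swap z0 z1 z2 z3 z4 :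
  quartic_disc z4 z3 z2 z1 z0 = quartic_disc z0 z1 z2 z3 z4.
Proof. by rewrite /quartic_disc; ring. Qed.

Lemma quartic_discZ c z0 z1 z2 z3 z4 :
  quartic_disc (c * z0) (c * z1) (c * z2) (c * z3) (c * z4) =
  c ^+ 6 * quartic_disc z0 z1 z2 z3 z4.
Proof. by rewrite /quartic_disc; ring. Qed.

Lemma quartic_sum_translate z0 z1 z2 z3 z4 c :
  quartic_sum z0 (z1 + z0 * c) z2 (z3 + z0 * c ^+ 3 - z2 * c)
    (quartic z0 z1 z2 z3 z4 c) = quartic_sum z0 z1 z2 z3 z4.
Proof.
rewrite /quartic_sum; congr (_ + _).
rewrite [RHS](reindex_inj (addIr c)); apply: eq_bigr => x _; congr quadchar.
by rewrite /quartic; ring3 char3.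
Qed.

(** The inversion x -> 1/x exchanges 0 and infinity, and changes the other values by fourth powers,
    which are squares. *)
Lemma quartic_sum_swap z0 z1 z2 z3 z4 :
  quartic_sum z4 z3 z2 z1 z0 = quartic_sum z0 z1 z2 z3 z4.
Proof.
have q0 a b c d e : quartic a b c d e 0 = e by rewrite /quartic; ring.
rewrite /quartic_sum (bigD1 0) //= [in RHS](bigD1 0) //= !q0 addrCA.
congr (_ + (_ + _)).
rewrite (reindex_inj invr_inj); apply: eq_big => [x | x]; first by rewrite invr_eq0.
rewrite invr_eq0 => x0; rewrite -[RHS](quadcharM _ (x := x^-1 ^+ 2)) ?expf_neq0 ?invr_eq0 //.
by congr quadchar; rewrite /quartic; field.
Qed.

Lemma quartic_sumZ c z0 z1 z2 z3 z4 : c != 0 ->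
  quartic_sum (c ^+ 2 * z0) (c ^+ 2 * z1) (c ^+ 2 * z2) (c ^+ 2 * z3) (c ^+ 2 * z4) =
  quartic_sum z0 z1 z2 z3 z4.
Proof.
move=> c0; rewrite /quartic_sum mulrC quadcharM //; congr (_ + _).
apply: eq_bigr => x _; rewrite -[RHS](quadcharM _ c0); congr quadchar.
by rewrite /quartic; ring.
Qed.

(* With a root at infinity the quartic is a cubic, and y = z1 x - z1 z3 brings it
   to the form (y^3 + y^2 - Delta) / z1^2. *)
Lemma quartic_sum_root z1 z3 z4 : quartic_disc 0 z1 1 z3 z4 != 0 ->
  quartic_sum 0 z1 1 z3 z4 = elliptic_sum (quartic_disc 0 z1 1 z3 z4).
Proof.
move=> D0; have z10 : z1 != 0.
  by apply: contraNneq D0 => ->; rewrite /quartic_disc; apply/eqP; ring.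
rewrite /quartic_sum {1}/quadchar eqxx add0r.
have injf : injective (fun x => z1 * x - z1 * z3).
  by move=> x y /addIr /(mulfI z10).
rewrite /elliptic_sum [RHS](reindex_inj injf); apply: eq_bigr => x _.
rewrite -(quadcharM _ z10); congr quadchar; rewrite /quartic /quartic_disc.
ring3 char3.
Qed.

(** Completing the square with 2 = -1: y = a x - b is a square root of the discriminant. *)
Lemma card_quadratic_roots a b c : a != 0 ->
  (#|[set x | a * x ^+ 2 + b * x + c == 0]|%:R : int) = 1 + quadchar (b ^+ 2 - a * c).
Proof.
move=> a0; rewrite -card_sqrt //; congr _%:R.
have injf : injective (fun y => (y + b) / a).
  by move=> x y /(mulIf (invr_neq0 a0)) /addIr.
rewrite -[RHS](card_imset _ injf); apply: eq_card => x; rewrite inE.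
have ex y : a * ((y + b) / a) ^+ 2 + b * ((y + b) / a) + c = (y ^+ 2 - (b ^+ 2 - a * c)) / a.
  transitivity ((y ^+ 2 - (b ^+ 2 - a * c)) / a + 3 * (b * y + b ^+ 2) / a); first by field.
  by rewrite char3 !mul0r addr0.
apply/eqP/imsetP => [e | [y]].
  exists (a * x - b); last by rewrite subrK mulrC mulKf.
  rewrite inE -subr_eq0 -[_ - _](mulfK (invr_neq0 a0)) -ex.
  by rewrite subrK [a * x]mulrC mulfK // e mul0r.
by rewrite inE => /eqP e ->; rewrite ex e subrr mul0r.
Qed.

(* The substitution w = x^2 + u turns w^2 = x^4 + h x^2 + c x + d into the quadratic
   equation (u + h) x^2 + c x + (d - u^2) = 0 in x. *)
Lemma quartic_sum_monic h c d : quartic_disc 1 0 h c d != 0 ->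
  quartic_sum 1 0 h c d =
  \sum_u quadchar (u ^+ 3 + h * u ^+ 2 - d * u + c ^+ 2 - h * d).
Proof.
move=> D0.
have chi1 : quadchar (1 : F) = 1.
  by rewrite /quadchar oner_eq0; case: issqP => // -[]; exists 1; rewrite expr1n.
have injf : injective (fun p : F * F => (p.2, p.1 + p.2 ^+ 2)).
  by move=> [u x] [v y] [/= -> /addIr ->].
have cnt := sum_card_sqrt char3 (quartic 1 0 h c d).
have eqN : #|[set p : F * F | p.2 ^+ 2 == quartic 1 0 h c d p.1]| =
    #|[set p : F * F | (p.1 + h) * p.2 ^+ 2 + c * p.2 + (d - p.1 ^+ 2) == 0]|.
  rewrite -[RHS](card_imset _ injf); apply: eq_card => -[x w].
  rewrite inE /=; apply/eqP/imsetP => [e | [[u y]]].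
    exists (w - x ^+ 2, x); rewrite ?inE /= ?subrK //; apply/eqP.
    transitivity (quartic 1 0 h c d x - w ^+ 2 + 3 * (w * x ^+ 2 - x ^+ 4)).
      by rewrite /quartic; ring.
    by rewrite e subrr char3 mul0r addr0.
  rewrite inE /= => /eqP e [-> ->].
  transitivity (quartic 1 0 h c d y -
    ((u + h) * y ^+ 2 + c * y + (d - u ^+ 2)) + 3 * (u * y ^+ 2)).
    by rewrite /quartic; ring.
  by rewrite e subr0 char3 mul0r addr0.
(* For u = - h the equation in x is linear. It has one root if c is non-zero; if c = 0 it has none,
   as d = h^2 would make the discriminant vanish. The formula for quadratics is one too large in
   both cases. *)
have cntu u : (#|[set x | (u + h) * x ^+ 2 + c * x + (d - u ^+ 2) == 0]|%:R : int) =
    1 + quadchar (u ^+ 3 + h * u ^+ 2 - d * u + c ^+ 2 - h * d) - (u == - h)%:R.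
  have -> : u ^+ 3 + h * u ^+ 2 - d * u + c ^+ 2 - h * d =
      c ^+ 2 - (u + h) * (d - u ^+ 2) by ring.
  have [-> | uh] := eqVneq u (- h); last first.
    by rewrite subr0 card_quadratic_roots // addr_eq0.
  rewrite addNr; under eq_finset do rewrite mul0r add0r.
  rewrite mul0r subr0; have [c0 | c0] := eqVneq c 0.
    rewrite c0 expr0n /quadchar eqxx /= addr0 subrr.
    suff -> : [set x | 0 * x + (d - (- h) ^+ 2) == 0] = set0 by rewrite cards0.
    apply/setP => x; rewrite !inE mul0r add0r; apply: contraNF D0.
    rewrite subr_eq0 => /eqP ->; apply/eqP; rewrite c0 /quartic_disc.
    ring3 char3.
  have -> : quadchar (c ^+ 2) = 1.
    by rewrite /quadchar expf_eq0 (negPf c0) /= issq_sqr.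
  suff -> : [set x | c * x + (d - (- h) ^+ 2) == 0] = [set - ((d - (- h) ^+ 2) / c)].
    by rewrite cards1.
  apply/setP => x; rewrite !inE addr_eq0 -[RHS](inj_eq (mulfI c0)) mulrN mulrC.
  by rewrite [c * (_ / c)]mulrC divfK // mulrC.
rewrite /quartic_sum chi1.
have -> : \sum_x quadchar (quartic 1 0 h c d x) =
    #|[set p : F * F | p.2 ^+ 2 == quartic 1 0 h c d p.1]|%:R - #|F|%:R.
  by rewrite cnt big_split /= sumr_const -[#|_|]/#|F| addrAC subrr add0r.
have -> : (#|[set p : F * F | p.2 ^+ 2 == quartic 1 0 h c d p.1]|%:R : int) =
   \sum_u #|[set x | (u + h) * x ^+ 2 + c * x + (d - u ^+ 2) == 0]|%:R.
  rewrite eqN -natr_sum -sum1dep_card; congr _%:R.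
  by under [RHS]eq_bigr do rewrite -sum1dep_card; rewrite pair_big_dep.
under eq_bigr do rewrite cntu.
(* The total correction of -1 cancels the term 1 contributed by the point at infinity. *)
have s1 : \sum_u (u == - h)%:R = 1 :> int.
  by rewrite (bigD1 (- h)) //= eqxx big1 ?addr0 // => u /negPf ->.
rewrite sumrB big_split /= sumr_const -[#|_|]/#|F| s1.
by ring.
Qed.

(** The substitution u = h y - d / h removes the linear term and brings out a factor h^3, which is a
    square because h is. *)
Lemma elliptic_sum_scale h c d : h != 0 -> issq h ->
  \sum_u quadchar (u ^+ 3 + h * u ^+ 2 - d * u + c ^+ 2 - h * d) =
  elliptic_sum (quartic_disc 1 0 h c d / h ^+ 6).
Proof.
move=> h0 /issqP[k hk].
have k0 : k != 0 by apply: contra_neq h0; rewrite hk => ->; rewrite expr0n.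
have injf : injective (fun y => h * y - d / h) by move=> x y /addIr /(mulfI h0).
rewrite (reindex_inj injf); apply: eq_bigr => y _.
rewrite -[RHS](quadcharM _ (x := k ^+ 3)) ?expf_neq0 //; congr quadchar.
rewrite -exprM mulnC exprM -hk /quartic_disc.
transitivity ((y ^+ 3 + y ^+ 2 - ((1 * d - 0 * c) ^+ 3 +
  (1 * d - 0 * c) ^+ 2 * h ^+ 2 - h ^+ 3 * (1 * c ^+ 2 + d * 0 ^+ 2 -
  1 * h * d)) / h ^+ 6) * h ^+ 3 +
  3 * (h * y * d ^+ 2 / h ^+ 2 - h ^+ 2 * y ^+ 2 * d / h - h * y * d + d ^+ 2 / h)).
  by field.
by rewrite char3 [X in _ + X]mul0r addr0.
Qed.

(** If n z0 = e^2, then n f is e^2 times the monic quartic f / z0. Translating by - z1 / z0 kills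
    its cubic term, since 4 = 1. The cases of interest are n = 1 and n = z0. *)
Lemma quartic_sum_sqr_monic n z0 z1 z2 z3 z4 : issq (n * z0) -> z0 != 0 ->
  z2 != 0 -> n != 0 -> quartic_disc z0 z1 z2 z3 z4 != 0 ->
  exists h c d, [/\ h = z2 / z0,
    quartic_disc 1 0 h c d = quartic_disc z0 z1 z2 z3 z4 / z0 ^+ 6
    & quartic_sum (n * z0) (n * z1) (n * z2) (n * z3) (n * z4) =
      quartic_sum 1 0 h c d].
Proof.
move=> /issqP[e nz] z00 z20 n0 D0.
have e0 : e != 0 by rewrite -sqrf_eq0 -nz mulf_neq0.
have s1 : n = e ^+ 2 * z0^-1 by rewrite -nz mulfK.
pose a := z1 / z0; pose b := z3 / z0; pose f := z4 / z0.
exists (z2 / z0), (b + 1 * (- a) ^+ 3 - z2 / z0 * (- a)),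
  (quartic 1 a (z2 / z0) b f (- a)); split=> //.
  have -> : 0 = a + 1 * - a by rewrite mul1r subrr.
  rewrite quartic_disc_translate; apply: (mulfI (expf_neq0 6 z00)).
  rewrite -quartic_discZ mulr1 /a /b /f ![z0 * (_ / _)]mulrC !divfK //.
  by rewrite mulrC divfK ?expf_neq0.
have -> : 0 = a + 1 * - a by rewrite mul1r subrr.
rewrite quartic_sum_translate -[RHS](quartic_sumZ _ _ _ _ _ e0) s1 /a /b /f.
by congr quartic_sum; field.
Qed.

Lemma quartic_sum_sqr z0 z1 z3 z4 : issq z0 -> quartic_disc z0 z1 1 z3 z4 != 0 ->
  quartic_sum z0 z1 1 z3 z4 = elliptic_sum (quartic_disc z0 z1 1 z3 z4).
Proof.
move=> sq D0; have [z00 | z00] := eqVneq z0 0.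
  by rewrite z00 in D0 *; exact: quartic_sum_root.
have sq1 : issq (1 * z0) by rewrite mul1r.
have [h [c [d [hE dE]]]] := quartic_sum_sqr_monic sq1 z00 (oner_neq0 F) (oner_neq0 F) D0.
have h0 : h != 0 by rewrite hE mul1r invr_neq0.
have D1 : quartic_disc 1 0 h c d != 0.
  by rewrite dE mulf_neq0 ?invr_eq0 ?expf_neq0.
(* Here h = 1 / z0 is a square along with z0, and the division by h^6 undoes the one by z0^6. *)
rewrite !mul1r => ->; rewrite quartic_sum_monic // elliptic_sum_scale //; last first.
  have /issqP[e eE] := sq; apply/issqP; exists e^-1.
  by rewrite hE eE mul1r exprVn.
by rewrite dE hE mul1r exprVn invrK divfK // expf_neq0.
Qed.

Lemma quadchar_le1 a : quadchar a <= 1.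
Proof. by rewrite /quadchar; case: ifP => // _; case: ifP. Qed.

(* If f takes no square value then every value of n f is a non-zero square, for n a
   non-square; as its character sum is at most #|F|, this is absurd. *)
Lemma quartic_has_square z0 z1 z3 z4 : quartic_disc z0 z1 1 z3 z4 != 0 ->
  issq z0 || [exists x, issq (quartic z0 z1 1 z3 z4 x)].
Proof.
move=> D0; apply/negPn/negP; rewrite negb_or negb_exists => /andP[nsq /forallP nsqx].
have nz c : ~~ issq c -> c != 0.
  by apply: contraNneq => ->; apply/issqP; exists 0; rewrite expr0n.
have chi1 c : ~~ issq c -> quadchar (z0 * c) = 1.
  by move=> nc; rewrite /quadchar mulf_eq0 !(negPf (nz _ _)) //= issqM_nonsq.
have [h [c [d [hE dE]]]] :=
  quartic_sum_sqr_monic (issq_sqr z0) (nz _ nsq) (oner_neq0 F) (nz _ nsq) D0.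
rewrite quartic_sum_monic; last by rewrite dE mulf_neq0 ?invr_eq0 ?expf_neq0 ?(nz _ nsq).
rewrite /quartic_sum chi1 //.
have -> : \sum_x quadchar (quartic (z0 * z0) (z0 * z1) (z0 * 1) (z0 * z3) (z0 * z4) x) = #|F|%:R.
  rewrite (eq_bigr (fun=> 1)) ?sumr_const // => x _.
  by rewrite -[RHS](chi1 _ (nsqx x)); congr quadchar; rewrite /quartic; ring.
move=> eS; have : 1 + #|F|%:R <= #|F|%:R :> int.
  by rewrite eS -[X in _ <= X]sumr_const; apply: ler_sum => u _; exact: quadchar_le1.
by rewrite gerDr.
Qed.

(** A point c with square value is translated to 0 and then swapped with infinity; both moves keep
    the middle coefficient equal to 1. *)
Lemma quartic_sumE z0 z1 z3 z4 : quartic_disc z0 z1 1 z3 z4 != 0 ->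
  quartic_sum z0 z1 1 z3 z4 = elliptic_sum (quartic_disc z0 z1 1 z3 z4).
Proof.
move=> D0; case/orP: (quartic_has_square D0) => [sq | /existsP[c sq]].
  exact: quartic_sum_sqr.
rewrite -(quartic_sum_translate _ _ _ _ _ c) -(quartic_disc_translate _ _ _ _ _ c) in D0 *.
by rewrite -quartic_sum_swap -quartic_disc_swap in D0 *; exact: quartic_sum_sqr.
Qed.

End QuarticCharacterSum.

(** * Rational points of the elliptic curve, and planes *)

Lemma dimv1P (K : fieldType) (vT : vectType K) (U : {vspace vT}) :
  \dim U = 1%N -> exists2 v, v != 0 & U = <[v]>%VS.
Proof.
move=> d1; have U0 : U != 0%VS by rewrite -dimv_eq0 d1.
exists (vpick U); first by rewrite vpick0.
apply/eqP; rewrite eq_sym eqEdim d1 dim_vline vpick0 U0 andbT.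
by rewrite -memvE memv_pick.
Qed.

Section Points.
Variable F : finFieldType.
Hypothesis char3 : 3%:R = 0 :> F.

Definition ell_eq (r : F) (v : 'rV[F]_3) : bool :=
  v 0 (inord 0) ^+ 2 * v 0 (inord 2) ==
  v 0 (inord 1) ^+ 3 + v 0 (inord 1) ^+ 2 * v 0 (inord 2) - r^-1 * v 0 (inord 2) ^+ 3.

Lemma ell_eqZ r k v : k != 0 -> ell_eq r (k *: v) = ell_eq r v.
Proof.
move=> k0; rewrite /ell_eq !mxE -[RHS](inj_eq (mulfI (expf_neq0 3 k0))).
by congr (_ == _); ring.
Qed.

(** The equation is homogeneous, so one representative of the point decides. *)
Lemma vline_elliptic r v : v != 0 -> (<[v]>%VS \in elliptic_points r) = ell_eq r v.
Proof.
move=> v0; rewrite inE dim_vline v0 /=; apply/forallP/idP => [/(_ v)|ev w].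
  by rewrite memv_line.
apply/implyP => /vlineP[k ->]; have [-> | k0] := eqVneq k 0.
  by rewrite scale0r /ell_eq !mxE; apply/eqP; ring.
by rewrite -[_ == _]/(ell_eq r (k *: v)) ell_eqZ.
Qed.

(** Pairs are ordered (y, x), so that the first component is the base variable of
    [sum_card_sqrt]. *)
Definition ell_point (p : option (F * F)) : 'rV[F]_3 :=
  if p is Some (y, x) then rowseq 2 [:: x; y; 1] else rowseq 2 [:: 1; 0; 0].

Lemma ell_point_neq0 p : ell_point p != 0.
Proof.
have n10 := oner_neq0 F.
by case: p => [[y x]|]; apply: contra_neq n10 => /rowP e;
  [move: (e (inord 2)) | move: (e (inord 0))]; rewrite !mxE inordK.
Qed.

Lemma ell_point_inj : injective (fun p => <[ell_point p]>%VS).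
Proof.
move=> p q e; have : ell_point p \in <[ell_point q]>%VS.
  by rewrite -[<[ell_point q]>%VS]e memv_line.
case/vlineP => k /rowP ek.
have k0 : k != 0.
  apply: contraNneq (ell_point_neq0 p) => k0; apply/eqP/rowP => i.
  by rewrite ek k0 scale0r.
move: (ek (inord 0)) (ek (inord 1)) (ek (inord 2)).
case: p {e ek} => [[y x]|]; case: q => [[y' x']|] //=; rewrite !mxE !inordK //= ?mulr0.
- by move=> -> -> e; rewrite mulr1 in e; rewrite -e !mul1r.
- by move=> _ _ /eqP; rewrite oner_eq0.
- by move=> _ _ /eqP; rewrite mulr1 eq_sym (negPf k0).
Qed.

(** On w = 0 the equation gives y^3 = 0, so (1:0:0) is the only point at infinity; the affine points
    are counted over y. *)
Lemma card_elliptic_points (r : F) :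
  (#|elliptic_points r|%:R : int) = 1 + #|F|%:R + elliptic_sum r^-1.
Proof.
pose A := [set p : option (F * F) |
  if p is Some yx then yx.2 ^+ 2 == yx.1 ^+ 3 + yx.1 ^+ 2 - r^-1 else true].
have inA p : (p \in A) = ell_eq r (ell_point p).
  rewrite inE /ell_eq; case: p => [[y x]|] /=; rewrite !rowseqE //=.
    by rewrite !expr1n !mulr1.
  by apply/esym/eqP; ring.
have -> : elliptic_points r = [set <[ell_point p]>%VS | p in A].
  apply/setP => U; apply/idP/imsetP => [UE | [p]]; last first.
    by rewrite inA => ep ->; rewrite vline_elliptic ?ell_point_neq0.
  have /dimv1P[v v0 eU] : \dim U = 1%N by move: UE; rewrite inE => /andP[/eqP].
  move: UE; rewrite eU vline_elliptic // => ev.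
  suff [p [k k0 e]] : exists p, exists2 k, k != 0 & v = k *: ell_point p.
    exists p; first by rewrite inA -(ell_eqZ _ _ k0) -e.
    apply/eqP; rewrite e eqEdim !dim_vline scaler_eq0 (negPf k0) ell_point_neq0.
    by rewrite -memvE memvZ ?memv_line.
  move: v0 ev; have [[|x [|y [|w []]]] // _ ->] := rowseqP v => v0.
  rewrite /ell_eq !rowseqE //=; have [w0 | w0 _] := eqVneq w 0.
    rewrite w0 expr0n !mulr0 subr0 addr0 eq_sym expf_eq0 /= => /eqP y0.
    exists None, x; [apply: contra_neq v0 => x0|]; apply/rowP => i;
      rewrite /ell_point !mxE ?x0 y0 ?w0; case: (val i) => [|[|[|j]]] //=;
      by rewrite ?nth_nil ?mulr1 ?mulr0.
  exists (Some (y / w, x / w)), w => //; apply/rowP => i; rewrite !mxE.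
  by case: (val i) => [|[|[|j]]] //=; rewrite ?nth_nil ?mulr1 ?mulr0 // mulrC divfK.
rewrite card_imset; last exact: ell_point_inj.
have -> : #|A| = (#|[set p : F * F | p.2 ^+ 2 == p.1 ^+ 3 + p.1 ^+ 2 - r^-1%R]|).+1.
  rewrite (cardsD1 None) inE -[X in _ = X.+1](card_imset _ (@Some_inj _)) add1n; congr (_.+1).
  apply: eq_card => -[yx|]; rewrite !inE /=; last by apply/esym/imsetP => -[].
  by apply/idP/imsetP => [e | [p + [->]]]; [exists yx; rewrite ?inE | rewrite inE].
rewrite -natr1 (sum_card_sqrt char3 (fun y => y ^+ 3 + y ^+ 2 - r^-1)).
by rewrite big_split /= sumr_const -[#|_|]/#|F| /elliptic_sum; ring.
Qed.

End Points.

(** * Planes and their equations *)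

Section Planes.
Variable F : finFieldType.
Implicit Types a b v : 'rV[F]_4.

Lemma mem_plane a v : (v \in plane a) = (v *m a^T == 0).
Proof. by rewrite memv_ker lfunE. Qed.

Lemma mem_planeE a v : (v \in plane a) = (\sum_i v 0 i * a 0 i == 0).
Proof.
rewrite mem_plane; have e : (v *m a^T) 0 0 = \sum_i v 0 i * a 0 i.
  by rewrite mxE; apply: eq_bigr => i _; rewrite mxE.
apply/eqP/eqP => [h | h]; first by rewrite -e h mxE.
by apply/matrixP => i j; rewrite !ord1 e h mxE.
Qed.

Lemma plane_scale a k : k != 0 -> plane (k *: a) = plane a.
Proof.
move=> k0; apply/vspaceP => v; rewrite !mem_plane linearZ /= -scalemxAr.
by rewrite scaler_eq0 (negPf k0).
Qed.

Lemma dim_plane a : a != 0 -> \dim (plane a) = 3.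
Proof.
move=> a0; pose f : 'Hom('rV[F]_4, 'rV[F]_1) := linfun (mulmxr a^T).
have := limg_ker_dim f fullv.
rewrite capfv dimvf dim_matrix -[lker f]/(plane a) => e.
have [i ai] : exists i, a 0 i != 0.
  apply/existsP; rewrite -negb_forall; apply: contra a0 => /forallP h.
  by apply/eqP/rowP => i; rewrite mxE; apply/eqP.
have e1 : \dim (limg f) = 1%N.
  apply/eqP; rewrite eqn_leq; apply/andP; split.
    by rewrite (leq_trans (dimvS (subvf _))) // dimvf dim_matrix.
  rewrite lt0n dimv_eq0; apply: contraNneq ai => l0.
  have : f (delta_mx 0 i) \in 0%VS by rewrite -l0 memv_img ?memvf.
  rewrite memv0 lfunE /= -rowE => /eqP/matrixP/(_ 0 0).
  by rewrite !mxE => ->.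
by move: e; rewrite e1 addn1 => -[].
Qed.

(** The vectors [a_i e_j - a_j e_i] lie in the plane of [a]; their lying in that of [b] says that
    the coefficients are proportional. *)
Lemma plane_eq a b : a != 0 -> b != 0 -> plane a = plane b ->
  exists2 k, k != 0 & b = k *: a.
Proof.
move=> a0 b0 e; have [i ai] : exists i, a 0 i != 0.
  apply/existsP; rewrite -negb_forall; apply: contra a0 => /forallP h.
  by apply/eqP/rowP => i; rewrite mxE; apply/eqP.
have prop j : b 0 j * a 0 i = b 0 i * a 0 j.
  have : a 0 i *: delta_mx 0 j - a 0 j *: delta_mx 0 i \in plane a.
    rewrite mem_plane mulmxBl -!scalemxAl -!rowE subr_eq0; apply/eqP/matrixP => k l.
    by rewrite !mxE !ord1 mulrC.
  rewrite e mem_plane mulmxBl -!scalemxAl -!rowE subr_eq0 => /eqP/matrixP/(_ 0 0).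
  by rewrite !mxE mulrC => ->; rewrite mulrC.
have eb : b = (b 0 i / a 0 i) *: a.
  by apply/rowP => j; rewrite !mxE mulrAC -prop mulfK.
exists (b 0 i / a 0 i) => //; apply: contra_neq b0 => k0.
by rewrite eb k0 scale0r.
Qed.

(** The three basis vectors impose three linear conditions on four coefficients, so a non-zero
    solution exists. *)
Lemma dim3_plane (H : {vspace 'rV[F]_4}) : \dim H = 3 ->
  exists2 a, a != 0 & H = plane a.
Proof.
move=> d3; pose B : 'M[F]_(\dim H, 4) := \matrix_(j, i) (vbasis H)`_j 0 i.
have ker0 : kermx B^T != 0.
  by rewrite kermx_eq0 /row_free neq_ltn (leq_ltn_trans (rank_leq_col _)) // d3.
have a0 : nz_row (kermx B^T) != 0 by rewrite nz_row_eq0.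
exists (nz_row (kermx B^T)) => //; set a := nz_row _ in a0 *.
have aB : a *m B^T = 0 by apply/sub_kermxP; exact: nz_row_sub.
apply/eqP; rewrite eqEdim d3 dim_plane // leqnn andbT.
rewrite -(span_basis (vbasisP H)); apply/span_subvP => u /(nthP 0)[j lt_j <-].
rewrite size_tuple in lt_j; rewrite mem_planeE.
have /rowP/(_ (Ordinal lt_j)) := aB; rewrite !mxE => h.
by rewrite -[X in _ == X]h; apply/eqP; apply: eq_bigr => i _; rewrite !mxE mulrC.
Qed.

(** A plane determines its cubic only up to a scalar, so for a scale-invariant property any equation
    decides. *)
Lemma mem_planes_with (Q : {mpoly F[2]} -> Prop) a : a != 0 ->
  (forall k f, k != 0 -> Q f -> Q (k *: f)) ->
  (plane a \in planes_with Q) = boolp.asbool (Q (bform a)).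
Proof.
move=> a0 QZ; apply/imsetP/idP => [[b] | Qa]; last first.
  by exists a; rewrite // inE a0.
rewrite inE => /andP[b0 /boolp.asboolP Qb] /esym/(plane_eq b0 a0)[k k0 ->].
by apply/boolp.asboolP; rewrite bformZ; exact: QZ.
Qed.

End Planes.

(** * Roots of the quartic f_L *)

Section QuarticRoots.
Variable F : finFieldType.
Hypothesis char3 : 3%:R = 0 :> F.
Implicit Types (z : 'rV[F]_5) (P Q R : option F).

(** The discriminant property that keeps the linear factors of f_L distinct when [Delta] is
    non-zero. *)
Lemma Delta_double_root z P (g : 'rV[F]_3) :
  bform z = bform (p1form P) ^+ 2 * bform g -> Delta z = 0.
Proof.
have [[|a [|b [|c []]]] // _ ->] := rowseqP g.
rewrite expr2; case: P => [t|]; rewrite /p1form bform11; last first.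
  by rewrite bform22 => /bform_inj ->; rewrite /Delta !rowseqE //=; ring.
have -> : 1 * - t + - t * 1 = t by ring3 char3.
by rewrite bform22 => /bform_inj ->; rewrite /Delta !rowseqE //=; ring3 char3.
Qed.

Lemma p1roots_linear (l : 'rV[F]_2) : l != 0 -> exists P, p1roots (bform l) = [set P].
Proof.
move=> /linear_form_root[c [P [c0 ->]]]; exists P.
by rewrite bformZ p1rootsZ // p1roots_p1form.
Qed.

Lemma Delta_disjoint_roots z (l1 l2 : 'rV[F]_2) (g : 'rV[F]_3) :
  bform z = bform l1 * bform l2 * bform g -> Delta z != 0 ->
  [/\ #|p1roots (bform l1)| = 1%N, #|p1roots (bform l2)| = 1%N
    & [disjoint p1roots (bform l1) & p1roots (bform l2)]].
Proof.
move=> e D0; have z0 : z != 0.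
  by apply: contraNneq D0 => ->; apply/eqP; rewrite /Delta !mxE; ring.
move: z0; rewrite -bform_eq0 e !mulf_eq0 !bform_eq0 !negb_or => /andP[/andP[l10 l20] _].
have [[c1 [P1 [c10 e1]]] [c2 [P2 [c20 e2]]]] := (linear_form_root l10, linear_form_root l20).
rewrite e1 e2 !bformZ !p1rootsZ // !p1roots_p1form !cards1; split=> //.
rewrite disjoints1 inE; apply: contra_neq D0 => P12.
apply: (Delta_double_root (P := P1) (g := (c1 * c2) *: g)).
by rewrite e e1 e2 P12 !bformZ -!mul_mpolyC rmorphM /=; ring.
Qed.

Lemma irreducible_p1roots n (g : 'rV[F]_n.+3) : (n <= 2)%N ->
  irreducible_elt (bform g) -> p1roots (bform g) = set0.
Proof.
move=> n2 irr; apply/setP => P; rewrite !inE.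
exact/negbTE/irreducible_bform_noroot.
Qed.

Lemma typeF1_roots z : typeF1 z -> #|p1roots (bform z)| = 1%N.
Proof.
case=> D0 [l [g [irr e]]].
have z0 : z != 0.
  by apply: contraNneq D0 => ->; apply/eqP; rewrite /Delta !mxE; ring.
move: z0; rewrite -bform_eq0 e mulf_eq0 !bform_eq0 negb_or => /andP[l0 _].
have [P eP] := p1roots_linear l0.
by rewrite p1rootsM irreducible_p1roots // setU0 eP cards1.
Qed.

Lemma typeF2_roots z : typeF2 z -> #|p1roots (bform z)| = 2%N.
Proof.
case=> D0 [l1 [l2 [g [irr e]]]].
have [c1 c2 dis] := Delta_disjoint_roots e D0.
by rewrite e !p1rootsM irreducible_p1roots // setU0 cardsU disjoint_setI0 // cards0 c1 c2.
Qed.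

Lemma typeF4_roots z : typeF4 z -> #|p1roots (bform z)| = 4%N.
Proof.
case=> D0 [l1 [l2 [l3 [l4 e]]]].
(* Each pair of linear factors is brought to the front in turn, the other two being merged into a
   quadratic. *)
have dis (m1 m2 m3 m4 : 'rV[F]_2) :
    bform z = bform m1 * bform m2 * (bform m3 * bform m4) ->
    [/\ #|p1roots (bform m1)| = 1%N, #|p1roots (bform m2)| = 1%N
    & [disjoint p1roots (bform m1) & p1roots (bform m2)]].
  have [g <-] := mul_linear m3 m4 => e'; exact: Delta_disjoint_roots e' D0.
have [c1 c2 d12] := dis l1 l2 l3 l4 ltac:(by rewrite e; ring).
have [_ c3 d13] := dis l1 l3 l2 l4 ltac:(by rewrite e; ring).
have [_ c4 d14] := dis l1 l4 l2 l3 ltac:(by rewrite e; ring).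
have [_ _ d23] := dis l2 l3 l1 l4 ltac:(by rewrite e; ring).
have [_ _ d24] := dis l2 l4 l1 l3 ltac:(by rewrite e; ring).
have [_ _ d34] := dis l3 l4 l1 l2 ltac:(by rewrite e; ring).
rewrite e !p1rootsM !cardsU !setIUl.
by rewrite !disjoint_setI0 // ?setU0 ?cards0 ?c1 ?c2 ?c3 ?c4.
Qed.

Lemma typeF'_roots z : typeF2' z \/ typeF4' z -> #|p1roots (bform z)| = 0%N.
Proof.
case=> [[_ irr] | [_ [g [h [irr1 irr2 ->]]]]].
  by rewrite irreducible_p1roots // cards0.
by rewrite p1rootsM !irreducible_p1roots // setU0 cards0.
Qed.

End QuarticRoots.

(** * Pencils of cubics *)

Lemma big_optionE (R : Type) (idx : R) (op : Monoid.com_law idx) (T : finType) (G : option T -> R) :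
  \big[op/idx]_P G P = op (G None) (\big[op/idx]_x G (Some x)).
Proof.
rewrite (bigD1 None) //=; congr (op _ _).
rewrite (reindex_omap Some id) => [|[]] //.
by apply: eq_bigl => x; rewrite /= eqxx.
Qed.

Section Pencil.
Variable F : finFieldType.
Hypothesis char3 : 3%:R = 0 :> F.
Variables al be ga de : F.
Implicit Types (P Q : option F).

(** The member with (a_1 : a_2) = (1 : t) or (0 : 1), where a_0 = - (al a_1 + be a_2) and a_3 = -
    (ga a_1 + de a_2). For a line, al, be, ga, de will be p_13, p_23, p_01, p_02 divided by p_03. *)
Definition pencil P : 'rV[F]_4 :=
  if P is Some t then rowseq 3 [:: - (al + be * t); 1; t; - (ga + de * t)]
  else rowseq 3 [:: - be; 0; 1; - de].

Definition pencil_quartic : 'rV[F]_5 := rowseq 4 [:: be; al; 1; de; ga].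

Lemma noncube_pencil P : noncube (pencil P).
Proof. by case: P => [t|]; rewrite /noncube !rowseqE //= oner_neq0 ?orbT. Qed.

Lemma pencil_neq0 P : pencil P != 0.
Proof. exact: noncube_neq0 (noncube_pencil P). Qed.

Lemma disc3_pencil P : disc3 (pencil P) = (bform pencil_quartic).@[p1pt P].
Proof.
rewrite meval_bform unlock /= !rowseqE //=.
by case: P => [t|]; rewrite /disc3 !rowseqE //=; ring.
Qed.

Lemma sum_quadchar_pencil :
  \sum_P quadchar (disc3 (pencil P)) = quartic_sum be al 1 de ga.
Proof.
rewrite big_optionE /quartic_sum; congr (quadchar _ + _).
  by rewrite /disc3 !rowseqE //=; ring.
apply: eq_bigr => t _; congr quadchar.
by rewrite /disc3 !rowseqE //= /quartic; ring.
Qed.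

Hypothesis Delta0 : quartic_disc be al 1 de ga != 0.

(** A common root s would express ga through al and de through be; one at infinity would force al =
    be = 0. Either way the discriminant vanishes. *)
Lemma pencil_no_base_point Q :
  (bform (pencil (Some 0))).@[p1pt Q] != 0 \/ (bform (pencil None)).@[p1pt Q] != 0.
Proof.
apply/orP; rewrite -negb_and; apply: contra Delta0 => /andP[/eqP + /eqP].
rewrite !meval_bform unlock /= !rowseqE //=; case: Q => [s|] /= u0 v0; apply/eqP.
  have -> : ga = s ^+ 2 - al * s ^+ 3 by apply: subr0_eq; rewrite -[RHS]oppr0 -[X in _ = - X]u0; ring.
  have -> : de = s - be * s ^+ 3 by apply: subr0_eq; rewrite -[RHS]oppr0 -[X in _ = - X]v0; ring.
  by rewrite /quartic_disc; ring3 char3.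
have -> : al = 0 by rewrite -[RHS]oppr0 -[X in _ = - X]u0; ring.
have -> : be = 0 by rewrite -[RHS]oppr0 -[X in _ = - X]v0; ring.
by rewrite /quartic_disc; ring.
Qed.

(** Having the root [Q] is a linear condition on the parameter, and a non-trivial one as there is no
    base point. *)
Lemma card_pencil_through Q : #|[set P | hasroot (bform (pencil P)) Q]| = 1%N.
Proof.
have evS t : (bform (pencil (Some t))).@[p1pt Q] =
    (bform (pencil (Some 0))).@[p1pt Q] + t * (bform (pencil None)).@[p1pt Q].
  by rewrite !meval_bform unlock /= !rowseqE //=; ring.
have := pencil_no_base_point Q; move: evS; rewrite /hasroot.
set u := (bform (pencil (Some 0))).@[_]; case: (eqVneq (bform (pencil None)).@[p1pt Q] 0) => [v0 | v0] evS.
  case=> // u0; rewrite -[RHS](cards1 (None : option F)); apply: eq_card => -[t|]; rewrite !inE ?v0 ?eqxx //.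
  by rewrite evS v0 mulr0 addr0 (negPf u0).
move=> _; rewrite -[RHS](cards1 (Some (- u / (bform (pencil None)).@[p1pt Q]))).
apply: eq_card => -[t|]; rewrite !inE ?(negPf v0) // evS.
by rewrite -[RHS]/(t == _) -[RHS](inj_eq (mulIf v0)) /= divfK // addrC addr_eq0.
Qed.

Lemma sum_card_roots_pencil :
  \sum_P #|p1roots (bform (pencil P))| = #|F|.+1.
Proof.
transitivity (\sum_Q #|[set P | hasroot (bform (pencil P)) Q]|).
  under eq_bigr do rewrite -sum1dep_card.
  under [RHS]eq_bigr do rewrite -sum1dep_card.
  by rewrite (exchange_big_dep xpredT).
by under eq_bigr do rewrite card_pencil_through; rewrite sum1_card card_option.
Qed.

(** Three linear equations determine the three unknown counts: [e1] counts the members of the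
    pencil, [e2] their roots, and [e3] evaluates the character sum. *)
Lemma pencil_counts (r : F) (i : nat) :
    r^-1 = quartic_disc be al 1 de ga ->
    #|p1roots (bform pencil_quartic)| = i ->
  let E : rat := #|elliptic_points r|%:R in
  [/\ #|[set P | disc3 (pencil P) == 0]| = i,
      #|[set P | ~~ issq (disc3 (pencil P))]|%:R = #|F|%:R + 1 - (E + i%:R) / 2,
      #|[set P | #|p1roots (bform (pencil P))| == 3%N]|%:R = (E - 3 * i%:R) / 6
    & #|[set P | #|p1roots (bform (pencil P))| == 0%N]|%:R = E / 3].
Proof.
move=> rE iE E.
have n2 : #|[set P | disc3 (pencil P) == 0]| = i.
  by rewrite -iE; apply: eq_card => P; rewrite !inE disc3_pencil.
set n4 := #|[set P | ~~ _]|; set n3 := #|[set P | _ == 3%N]|; set n5 := #|[set P | _ == 0%N]|.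
have cl P : [/\ ((disc3 (pencil P) == 0%R) + (#|p1roots (bform (pencil P))| == 3)
      + (~~ issq (disc3 (pencil P))) + (#|p1roots (bform (pencil P))| == 0) = 1)%N,
    (#|p1roots (bform (pencil P))| = 2 * (disc3 (pencil P) == 0%R) +
      3 * (#|p1roots (bform (pencil P))| == 3) + (~~ issq (disc3 (pencil P))))%N
    & quadchar (disc3 (pencil P)) + (~~ issq (disc3 (pencil P)))%:R =
      (#|p1roots (bform (pencil P))| == 3%N)%:R + (#|p1roots (bform (pencil P))| == 0%N)%:R :> int].
  have [_] := cubic_classes char3 (noncube_pencil P); rewrite /quadchar.
  set R := #|_|; have [-> | D0] := eqVneq (disc3 (pencil P)) 0.
    have -> : issq (0 : F) by apply/issqP; exists 0; rewrite expr0n.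
    by move=> ->.
  by case: (issq _) => [|-> //]; case: eqP => [-> _ | _ ->].
have cE (b : pred (option F)) : #|[set P | b P]| = (\sum_P b P)%N.
  by rewrite -sum1dep_card big_mkcond.
have e1 : (i + n3 + n4 + n5 = #|F|.+1)%N.
  rewrite -n2 /n3 /n4 /n5 !cE -!big_split /= -card_option -sum1_card.
  by apply: eq_bigr => P _; have [] := cl P.
have e2 : (2 * i + 3 * n3 + n4 = #|F|.+1)%N.
  rewrite -n2 /n3 /n4 !cE !big_distrr -!big_split /= -sum_card_roots_pencil.
  by apply: eq_bigr => P _; have [] := cl P.
have e3 : (#|elliptic_points r| + n4 = #|F|.+1 + n3 + n5)%N.
  have e : \sum_P quadchar (disc3 (pencil P)) + n4%:R = n3%:R + n5%:R :> int.
    rewrite /n3 /n4 /n5 !cE !natr_sum -!big_split /=.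
    by apply: eq_bigr => P _; have [] := cl P.
  apply/eqP; rewrite -(eqr_nat int) !natrD card_elliptic_points // rE -quartic_sumE //.
  by rewrite -sum_quadchar_pencil -addrA e -[#|F|.+1%:R]natr1; apply/eqP; ring.
have r1 : i%:R + n3%:R + n4%:R + n5%:R = #|F|%:R + 1 :> rat.
  by rewrite natr1 -e1 !natrD.
have r2 : 2 * i%:R + 3 * n3%:R + n4%:R = #|F|%:R + 1 :> rat.
  by rewrite natr1 -e2 2!natrD !natrM.
have r3 : E + n4%:R = #|F|%:R + 1 + n3%:R + n5%:R.
  by rewrite natr1 /E -[LHS]natrD e3 !natrD.
split=> //; lra.
Qed.

End Pencil.

(** * Planes through a line *)

Section ScaleInvariance.
Variable F : finFieldType.
Hypothesis char3 : 3%:R = 0 :> F.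
Implicit Types (f : {mpoly F[2]}) (k : F).

(** Frobenius is injective, hence onto. Cube roots absorb scalars into cubes of linear forms and
    turn coefficients of planes into parameters of osculating planes. *)
Lemma cube_surj k : exists c, c ^+ 3 = k.
Proof.
have inj : injective (fun c : F => c ^+ 3).
  move=> c d /= e; apply/eqP; rewrite -subr_eq0.
  have : (c - d) ^+ 3 = c ^+ 3 - d ^+ 3 by ring3 char3.
  by rewrite e subrr => /eqP; rewrite expf_eq0.
by have [g _ gK] := injF_bij inj; exists (g k).
Qed.

Lemma free2_scale k (l1 l2 : 'rV[F]_2) :
  k != 0 -> free [:: l1; l2] -> free [:: l1; k *: l2].
Proof.
move=> k0 /free2_linear[c [d [P [Q [-> -> c0 d0 PQ]]]]].
by rewrite scalerA free2_p1form c0 mulf_neq0.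
Qed.

Lemma N1formZ k f : k != 0 -> N1form f -> N1form (k *: f).
Proof.
move=> _ [l ->]; have [c <-] := cube_surj k; exists (c *: l).
by rewrite bformZ exprZn.
Qed.

Lemma N2formZ k f : k != 0 -> N2form f -> N2form (k *: f).
Proof.
move=> k0 [l1 [l2 [fr ->]]]; exists l1, (k *: l2).
by rewrite bformZ scalerAr free2_scale.
Qed.

Lemma N3formZ k f : k != 0 -> N3form f -> N3form (k *: f).
Proof.
move=> k0 [l1 [l2 [l3 [fr1 fr2 fr3 ->]]]]; exists l1, l2, (k *: l3).
by rewrite bformZ scalerAr !free2_scale.
Qed.

Lemma N4formZ k f : k != 0 -> N4form f -> N4form (k *: f).
Proof.
move=> k0 [l [g [irr ->]]]; exists (k *: l), g.
by rewrite bformZ scalerAl.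
Qed.

Lemma irreducible_eltZ k f : k != 0 -> irreducible_elt f -> irreducible_elt (k *: f).
Proof.
move=> k0 [f0 nu irr].
have ku c : c != 0 -> (c%:MP : {mpoly F[2]}) \is a GRing.unit.
  by move=> c0; rewrite rmorph_unit ?unitfE.
rewrite -mul_mpolyC; split; first by rewrite mulf_neq0 ?mpolyC_eq0.
- by rewrite unitrM ku.
- move=> g h e; have : f = k^-1%:MP * g * h.
    by rewrite -mulrA -e mulrA -rmorphM mulVf // rmorph1 mul1r.
  by case/irr; [rewrite unitrM => /andP[_]; left | right].
Qed.
End ScaleInvariance.

(** * The pencil of cubics attached to a line *)

Section LinePencil.
Variable F : finFieldType.
Hypothesis char3 : 3%:R = 0 :> F.
Variables x y : 'rV[F]_4.

Lemma mem_plane_coords (v a : 'rV[F]_4) : (v \in plane a) =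
  (v 0 y0 * a 0 y0 + v 0 y1 * a 0 y1 + v 0 y2 * a 0 y2 + v 0 y3 * a 0 y3 == 0).
Proof.
rewrite mem_planeE !big_ord_recl big_ord0 addr0 !addrA.
by congr (v 0 _ * a 0 _ + v 0 _ * a 0 _ + v 0 _ * a 0 _ + v 0 _ * a 0 _ == 0); apply: val_inj.
Qed.

Lemma line_sub_plane (a : 'rV[F]_4) :
  (<<[:: x; y]>> <= plane a)%VS = (x \in plane a) && (y \in plane a).
Proof.
apply/span_subvP/andP => [h | [hx hy] v].
  by split; apply: h; rewrite !inE eqxx ?orbT.
by rewrite !inE => /orP[] /eqP ->.
Qed.

(** If p_03 = 0, the coordinates 0 and 3 of [x] and [y] are proportional, so some non-zero A y_0 + B
    y_3 vanishes on the line. With A = t^3 and B = s^3 this is the osculating plane at the parameter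
    (-s, t). *)
Lemma plucker03_neq0 :
  (forall s t : F, (s, t) != (0, 0) -> ~~ (<<[:: x; y]>> <= osc_plane s t)%VS) ->
  plucker x y y0 y3 != 0.
Proof.
move=> osc; apply/eqP => p0; rewrite /plucker in p0.
have [A [B [AB hx hy]]] : exists A B, [/\ (A, B) != (0, 0),
    A * x 0 y0 + B * x 0 y3 = 0 & A * y 0 y0 + B * y 0 y3 = 0].
  have [x03 | x03] := eqVneq (x 0 y0, x 0 y3) (0, 0); last first.
    exists (x 0 y3), (- x 0 y0); split.
    - by move: x03; rewrite !xpair_eqE oppr_eq0 andbC.
    - by ring.
    - by rewrite -[RHS]oppr0 -[X in _ = - X]p0; ring.
  case: x03 => x00 x30.
  have [y03 | y03] := eqVneq (y 0 y0, y 0 y3) (0, 0).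
    case: y03 => -> ->; exists 1, 0; rewrite xpair_eqE oner_eq0 x00 x30.
    by split=> //; ring.
  exists (y 0 y3), (- y 0 y0); split.
  - by move: y03; rewrite !xpair_eqE oppr_eq0 andbC.
  - by rewrite x00 x30; ring.
  - by ring.
have [t tA] := cube_surj char3 A; have [s sB] := cube_surj char3 B.
have st : (s, t) != (0, 0).
  apply: contra_neq AB => -[s0 t0]; rewrite -tA -sB s0 t0 !expr0n; congr (_, _).
have /osc/negP[] : (- s, t) != (0, 0) by move: st; rewrite !xpair_eqE oppr_eq0.
rewrite line_sub_plane !mem_plane_coords !mxE !(tnth_nth 0) /=.
apply/andP; split; apply/eqP.
  by rewrite -[RHS]hx -tA -sB; ring.
by rewrite -[RHS]hy -tA -sB; ring.
Qed.

Hypothesis p0 : plucker x y y0 y3 != 0.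
Let p := plucker x y.
Let al := p y1 y3 / p y0 y3.
Let be := p y2 y3 / p y0 y3.
Let ga := p y0 y1 / p y0 y3.
Let de := p y0 y2 / p y0 y3.
Notation pc := (pencil al be ga de).

Lemma line_quarticE : line_quartic x y = p y0 y3 *: pencil_quartic al be ga de.
Proof.
have e a : p y0 y3 * (a / p y0 y3) = a by rewrite mulrC divfK.
apply/rowP => i; rewrite !mxE (tnth_nth 0).
by case: i => [[|[|[|[|[|i]]]]] lt] //=; rewrite ?e ?mulr1.
Qed.

Lemma Delta_line_quartic :
  Delta (line_quartic x y) = p y0 y3 ^+ 6 * quartic_disc be al 1 de ga.
Proof.
rewrite line_quarticE -quartic_discZ /Delta /quartic_disc.
by rewrite !mxE !inordK.
Qed.

Lemma jmath_line_quartic :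
  (jmath (line_quartic x y))^-1 = quartic_disc be al 1 de ga.
Proof.
rewrite /jmath Delta_line_quartic line_quarticE !mxE inordK //= mulr1 invf_div.
by rewrite mulrC mulKf // expf_neq0.
Qed.

Lemma p1roots_line_quartic :
  p1roots (bform (line_quartic x y)) = p1roots (bform (pencil_quartic al be ga de)).
Proof. by rewrite line_quarticE bformZ p1rootsZ. Qed.

Lemma line_sub_pencil P : (<<[:: x; y]>> <= plane (pc P))%VS.
Proof.
rewrite line_sub_plane !mem_plane_coords.
move: p0; rewrite /al /be /ga /de /p /plucker => q0.
case: P => [t|]; rewrite !mxE /=; apply/andP; split; apply/eqP;
  by field.
Qed.

Lemma plane_through_pencil (a : 'rV[F]_4) : a != 0 ->
  (<<[:: x; y]>> <= plane a)%VS -> exists P, plane a = plane (pc P).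
Proof.
have [[|a0 [|a1 [|a2 [|a3 []]]]] // _ ->] := rowseqP a => an0.
rewrite line_sub_plane !mem_plane_coords !mxE /= => /andP[/eqP hx /eqP hy].
pose X := x 0 y0 * a0 + x 0 y1 * a1 + x 0 y2 * a2 + x 0 y3 * a3.
pose Y := y 0 y0 * a0 + y 0 y1 * a1 + y 0 y2 * a2 + y 0 y3 * a3.
(* Eliminating [a3] between the two incidence equations gives [a0]; eliminating [a0] gives [a3]
   below. *)
have e0 : a0 = - (al * a1 + be * a2).
  have h : p y0 y3 * a0 + p y1 y3 * a1 + p y2 y3 * a2 = 0.
    transitivity (y 0 y3 * X - x 0 y3 * Y); first by rewrite /p /plucker /X /Y; ring.
    by rewrite /X /Y hx hy !mulr0 subrr.
  transitivity (a0 - (p y0 y3 * a0 + p y1 y3 * a1 + p y2 y3 * a2) / p y0 y3).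
    by rewrite h mul0r subr0.
  by rewrite /al /be; field.
have e3 : a3 = - (ga * a1 + de * a2).
  have h : p y0 y3 * a3 + p y0 y1 * a1 + p y0 y2 * a2 = 0.
    transitivity (x 0 y0 * Y - y 0 y0 * X); first by rewrite /p /plucker /X /Y; ring.
    by rewrite /X /Y hx hy !mulr0 subrr.
  transitivity (a3 - (p y0 y3 * a3 + p y0 y1 * a1 + p y0 y2 * a2) / p y0 y3).
    by rewrite h mul0r subr0.
  by rewrite /ga /de; field.
have [a10 | a10] := eqVneq a1 0.
  have a20 : a2 != 0.
    apply: contra_neq an0 => a20; apply/rowP => i; rewrite e0 e3 a10 a20 !mxE.
    by case: (val i) => [|[|[|[|j]]]] //=; rewrite ?nth_nil ?mulr0 ?addr0 ?oppr0.
  exists None; rewrite -[RHS](plane_scale _ a20); congr plane; apply/rowP => i.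
  rewrite e0 e3 a10 !mxE.
  by case: (val i) => [|[|[|[|j]]]] //=; rewrite ?nth_nil; ring.
exists (Some (a2 / a1)); rewrite -[RHS](plane_scale _ a10); congr plane; apply/rowP => i.
rewrite e0 e3 !mxE.
by case: (val i) => [|[|[|[|j]]]] //=; rewrite ?nth_nil; field.
Qed.

Lemma planes_through_pencil :
  planes_through <<[:: x; y]>>%VS = [set plane (pc P) | P : option F].
Proof.
apply/setP => H; rewrite inE; apply/andP/imsetP => [[/eqP d3 sub] | [P _ ->]].
  have [a a0 eH] := dim3_plane d3; rewrite eH in sub *.
  by have [P ->] := plane_through_pencil a0 sub; exists P.
by rewrite dim_plane ?pencil_neq0 // line_sub_pencil.
Qed.

(** The middle coefficients (1 : t) and (0 : 1) are pairwise non-proportional. *)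
Lemma pencil_plane_inj : injective (fun P => plane (pc P)).
Proof.
move=> P Q /(plane_eq (pencil_neq0 _ _ _ _ _) (pencil_neq0 _ _ _ _ _))[k k0 /rowP e].
move: (e (inord 1)) (e (inord 2)); case: P Q {e} => [t|] [s|] //; rewrite !mxE !inordK //= ?mulr1.
- by move=> <-; rewrite mul1r => ->.
- by move=> /esym/eqP; rewrite (negPf k0).
- by rewrite mulr0 => /eqP; rewrite oner_eq0.
Qed.

Lemma card_planes_with (Q : {mpoly F[2]} -> Prop) :
  (forall k f, k != 0 -> Q f -> Q (k *: f)) ->
  #|planes_through <<[:: x; y]>>%VS :&: planes_with Q| =
  #|[set P | boolp.asbool (Q (bform (pc P)))]|.
Proof.
move=> QZ; rewrite planes_through_pencil -[RHS](card_imset _ pencil_plane_inj).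
apply: eq_card => H; rewrite inE; apply/andP/imsetP => [[/imsetP[P _ ->]] | [P + ->]].
  by rewrite mem_planes_with ?pencil_neq0 // => QP; exists P; rewrite ?inE.
rewrite inE => QP; split; first by apply/imsetP; exists P.
by rewrite mem_planes_with ?pencil_neq0.
Qed.

(** Both parts of the theorem at once: [i] is the number of rational roots of f_L, which is 0 for
    the types F_2' and F_4'. *)
Lemma line_counts (i : nat) : Delta (line_quartic x y) != 0 ->
  #|p1roots (bform (line_quartic x y))| = i ->
  let S := planes_through <<[:: x; y]>>%VS in
  let E : rat := #|elliptic_points (jmath (line_quartic x y))|%:R in
  [/\ #|S :&: N1 F| = 0%N,
      #|S :&: N2 F| = i,
      #|S :&: N4 F|%:R = #|F|%:R + 1 - (E + i%:R) / 2,
      #|S :&: N3 F|%:R = (E - 3 * i%:R) / 6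
    & #|S :&: N5 F|%:R = E / 3].
Proof.
move=> D0 iE S E.
have q0 : quartic_disc be al 1 de ga != 0.
  by move: D0; rewrite Delta_line_quartic mulf_eq0 negb_or => /andP[].
rewrite p1roots_line_quartic in iE.
have [c2 c4 c3 c5] := pencil_counts char3 q0 jmath_line_quartic iE.
have cls P := (cubic_classes char3 (noncube_pencil al be ga de P)).1.
have asb (Q : {mpoly F[2]} -> Prop) (b : pred (option F)) :
    (forall k f, k != 0 -> Q f -> Q (k *: f)) ->
    (forall P, Q (bform (pc P)) <-> b P) ->
    #|S :&: planes_with Q| = #|[set P | b P]|.
  move=> QZ Qb; rewrite card_planes_with //; apply: eq_card => P; rewrite !inE.
  by apply/boolp.asboolP/idP => /Qb.
split.
- rewrite (asb _ pred0 (@N1formZ _ char3)); last by move=> P; have [no _ _ _ _] := cls P; split.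
  by apply: eq_card0 => P; rewrite inE.
- rewrite -c2; apply: asb (@N2formZ F) _ => P; have [_ -> _ _ _] := cls P.
  by split=> /eqP.
- by rewrite -c4; congr _%:R; apply: asb (@N4formZ F) _ => P; have [_ _ _ h _] := cls P.
- rewrite -c3; congr _%:R; apply: asb (@N3formZ F) _ => P; have [_ _ -> _ _] := cls P.
  by split=> /eqP.
- rewrite -c5; congr _%:R; apply: asb (@irreducible_eltZ F) _ => P; have [_ _ _ _ ->] := cls P.
  by split=> /eqP.
Qed.
End LinePencil.

Lemma card_pow3_char3 (F : finFieldType) m : #|F| = (3 ^ m)%N -> 3%:R = 0 :> F.
Proof.
by move=> /card_finPcharP/(_ isT)/pcharf0.
Qed.

Theorem theorem1p7 (q m : nat) (hq : q = (3 ^ m)%N)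
    (F : finFieldType) (hF : #|F| = q)
    (* K is an algebraic closure of F *)
    (K : closedFieldType) (iota : {rmorphism F -> K})
    (hK : integralRange iota)
    (L : {vspace 'rV[F]_4}) (hL : \dim L = 2%N) (hgen : generic iota L)
    (x y : 'rV[F]_4) (hxy : <<[:: x; y]>>%VS = L) :
  let S := planes_through L in
  let fL := line_quartic x y in
  let r := jmath fL in
  let E : rat := #|elliptic_points r|%:R in
  (forall i : nat,
     [\/ i = 1%N /\ typeF1 fL, i = 2%N /\ typeF2 fL | i = 4%N /\ typeF4 fL] ->
     [/\ #|S :&: N1 F| = 0%N,
         #|S :&: N2 F| = i,
         #|S :&: N4 F|%:R = q%:R + 1 - (E + i%:R) / 2,
         #|S :&: N3 F|%:R = (E - 3 * i%:R) / 6
       & #|S :&: N5 F|%:R = E / 3])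
  /\
  (typeF2' fL \/ typeF4' fL ->
     [/\ #|S :&: N1 F| = 0%N,
         #|S :&: N2 F| = 0%N,
         #|S :&: N4 F|%:R = q%:R + 1 - E / 2,
         #|S :&: N3 F|%:R = E / 6
       & #|S :&: N5 F|%:R = E / 3]).
Proof.
have char3 : 3%:R = 0 :> F by apply: (@card_pow3_char3 F m); rewrite hF.
case: hgen => _; rewrite -hxy => /(plucker03_neq0 char3) p0.
rewrite -hF; move=> S fL r E; split=> [i ti | t0].
  have [D0 iE] : Delta fL != 0 /\ #|p1roots (bform fL)| = i.
    case: ti => -[-> t]; (split; first by case: t).
    - exact: typeF1_roots.
    - exact: typeF2_roots.
    - exact: typeF4_roots.
  exact: (line_counts char3 p0 D0 iE).
have D0 : Delta fL != 0 by case: t0 => -[].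
(* The uniform count with i = 0, whose terms in i then disappear. *)
have := line_counts char3 p0 D0 (typeF'_roots t0).
by rewrite /= !mulr0n mulr0 !subr0.
Qed.
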